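(* Let $k \ge 4$ be a fixed integer. There exist a constant $c = c(k) > 0$ and an integer $n_0$ such that for every $n \ge n_0$, every $(n,k,k-2)$-omitting system has an independent set of size at least $c\, n^{2/(k-1)} (\log \log n)^{1/(k-1)}$. In other words, $g(n,k,k-2) = \Omega\left(n^{\frac{2}{k-1}} (\log\log n)^{\frac{1}{k-1}}\right)$.
   Context: A $k$-uniform hypergraph ($k$-graph) is a family of $k$-element subsets (edges) of a finite vertex set. A set of vertices is independent if it contains no edge; $\alpha(\mathcal{H})$ is the maximum size of an independent set. For integers $k > \ell \ge 1$, an $(n,k,\ell)$-omitting system is a $k$-graph on $n$ vertices with no two edges whose intersection has size exactly $\ell$. $g(n,k,\ell)$ denotes the minimum of $\alpha(\mathcal{H})$ over all $(n,k,\ell)$-omitting systems $\mathcal{H}$. Asymptotic notation is with respect to $n \to \infty$ with $k$ fixed. *)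

(* Defs.v *)
From mathcomp Require Import all_boot.

Set Implicit Arguments.
Unset Strict Implicit.
Unset Printing Implicit Defensive.

Section Hypergraph.
Variable T : finType.
Implicit Types (H : {set {set T}}) (S : {set T}).

Definition uniform (k : nat) H := [forall A in H, #|A| == k].

Definition independent H S := ~~ [exists A in H, A \subset S].

Definition alpha H : nat := \max_(S : {set T} | independent H S) #|S|.

Definition omitting_system (n k l : nat) H :=
  [&& #|T| == n, uniform k H &
      [forall A in H, forall B in H, (A != B) ==> (#|A :&: B| != l)]].

End Hypergraph.

Lemma omitting_system0 (n k l : nat) :
  omitting_system n k l (set0 : {set {set 'I_n}}).
Proof.
by rewrite /omitting_system card_ord eqxx /=; apply/andP; split;
  apply/forall_inP => A; rewrite inE.
Qed.

(* [set0] is only the starting point of the minimisation; it is legitimate by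
   [omitting_system0]. *)
Definition g (n k l : nat) : nat :=
  alpha [arg min_(H < (set0 : {set {set 'I_n}}) | omitting_system n k l H)
           alpha H].

Lemma g_spec (n k l : nat) :
  (exists2 H : {set {set 'I_n}}, omitting_system n k l H & g n k l = alpha H)
  /\ (forall H : {set {set 'I_n}}, omitting_system n k l H ->
        g n k l <= alpha H).
Proof.
rewrite /g; case: arg_minnP => [|H HP Hmin]; first exact: omitting_system0.
by split; [exists H | exact: Hmin].
Qed.

(* Main.v *)
Require Import Defs.
From mathcomp Require Import all_boot all_order all_algebra.
From mathcomp Require Import perm reals sequences exp.
From mathcomp Require Import zify ring lra.

(** In a [k]-graph omitting the intersection size [k - 2], "sharing at least
    [k - 2] vertices" is an equivalence relation on the edges: edges of one class
    share at least [k - 1] vertices, edges of different classes at most [k - 3].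
    A first-moment deletion argument applied to a random sample of about
    [n^(2/(k-1))] (up to a power of [log n]) vertices leaves a vertex set [A] in
    which the degrees are at most a power [d] of [log n] and in which no closed
    walk, along edges of distinct consecutive classes, has length at most [2 Q],
    where [Q] is a smaller power of [log n].

    On [A] every vertex gets a random round among [Q]. A vertex is accepted in its
    round unless some class blocks it, i.e. contains an edge all of whose other
    vertices were accepted earlier (or are processed in the same round); in this
    recursion the acceptance of the other vertices ignores the blocking class, so
    that by acyclicity all the events involved are independent. Vertices whose
    acceptance probability has reached [1/Q] are no longer accepted. Because of
    this cap a vertex stays unblocked with probability at least
    [exp(- 2 d (5/Q)^(k-1))], which exceeds [2/Q] if [d] is a small multiple of
    [Q^(k-1) log Q]; hence within [Q] rounds every vertex reaches the cap and the
    accepted vertices form an independent set of expected size [|A|/Q]. The factor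
    [log Q], of order [log log n], in the choice of [d] is the gain over the
    trivial bound. *)

Set Implicit Arguments.
Unset Strict Implicit.
Unset Printing Implicit Defensive.

Import Order.TTheory GRing.Theory Num.Theory.
Local Open Scope ring_scope.

(** * Independence of functions of disjoint coordinates *)

Section Independence.
Variables (R : realType) (T S : finType).
Hypothesis S_gt0 : (0 < #|S|)%N.
Local Notation Omega := {ffun T -> S}.
Implicit Types (A B : {set T}) (t : Omega).

Definition mean (f : Omega -> R) : R := (\sum_t f t) / #|{: Omega}|%:R.

Definition depends A (X : Type) (f : Omega -> X) :=
  forall t t', {in A, t =1 t'} -> f t = f t'.

Lemma card_Omega_gt0 : 0 < #|{: Omega}|%:R :> R.
Proof. by rewrite ltr0n card_ffun expn_gt0 S_gt0. Qed.

Lemma depends_comp A X Y (g : X -> Y) (f : Omega -> X) :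
  depends A f -> depends A (fun t => g (f t)).
Proof. by move=> fA t t' /fA ->. Qed.

Lemma mean_cst (a : R) : mean (fun=> a) = a.
Proof.
by rewrite /mean sumr_const -[a *+ _]mulr_natr mulfK // gt_eqF // card_Omega_gt0.
Qed.

Lemma eq_mean f g : f =1 g -> mean f = mean g.
Proof. by move=> fg; rewrite /mean (eq_bigr g). Qed.

Lemma meanD f g : mean (fun t => f t + g t) = mean f + mean g.
Proof. by rewrite /mean big_split mulrDl. Qed.

Lemma meanB f g : mean (fun t => f t - g t) = mean f - mean g.
Proof. by rewrite /mean big_split sumrN mulrBl. Qed.

Lemma meanZ a f : mean (fun t => a * f t) = a * mean f.
Proof. by rewrite /mean -mulr_sumr mulrA. Qed.

Lemma mean_sum (I : Type) (r : seq I) (P : pred I) (F : I -> Omega -> R) :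
  mean (fun t => \sum_(i <- r | P i) F i t) = \sum_(i <- r | P i) mean (F i).
Proof. by rewrite /mean exchange_big mulr_suml. Qed.

Lemma le_mean f g : (forall t, f t <= g t) -> mean f <= mean g.
Proof. by move=> fg; rewrite ler_wpM2r ?invr_ge0 ?ler0n // ler_sum. Qed.

Lemma mean_ge0 f : (forall t, 0 <= f t) -> 0 <= mean f.
Proof. by move=> f0; rewrite -(mean_cst 0) le_mean. Qed.

Lemma mean_le_exists f : exists t, mean f <= f t.
Proof.
have [/existsP[t Ht]|/existsPn H] := boolP [exists t, mean f <= f t].
  by exists t.
have s0 : S by apply: (enum_val (A := S) (Ordinal S_gt0)).
suff : mean f < mean f by rewrite ltxx.
rewrite {1}/mean ltr_pdivrMr ?card_Omega_gt0 //.
rewrite mulr_natr -sumr_const.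
apply: ltr_sum => [|t _]; last by rewrite ltNge H.
by apply/hasP; exists [ffun=> s0]; rewrite ?mem_index_enum.
Qed.

(* Exchanging the coordinates in [A] of two independent copies is a
   measure-preserving involution of the pairs. *)
Lemma mean_mul_disjoint A B (f g : Omega -> R) :
  depends A f -> depends B g -> [disjoint A & B] ->
  mean (fun t => f t * g t) = mean f * mean g.
Proof.
move=> fA gB AB; set N := #|{: Omega}|%:R : R.
have N0 : N != 0 by rewrite gt_eqF // card_Omega_gt0.
pose mix t t' : Omega := [ffun v => if v \in A then t v else t' v].
pose sw (x : Omega * Omega) := (mix x.1 x.2, mix x.2 x.1).
have swK : involutive sw.
  case=> t t'; rewrite /sw /=; congr pair; apply/ffunP => v; rewrite !ffunE;
  by case: ifP => // ->.
have key : \sum_t \sum_t' f t * g t' = \sum_t \sum_(t' : Omega) f t * g t.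
  rewrite !pair_big /= (reindex_inj (inv_inj swK)) /=.
  apply: eq_bigr => -[t t'] _ /=; congr (_ * _).
    by apply: fA => v vA; rewrite ffunE vA.
  by apply: gB => v vB; rewrite ffunE (disjointFl AB).
rewrite /mean -/N; apply: (mulIf N0); apply: (mulIf N0).
transitivity (\sum_t \sum_(t' : Omega) f t * g t).
  under [RHS]eq_bigr => t _ do rewrite sumr_const -mulr_natr.
  by rewrite -mulr_suml -/N divfK.
rewrite -key; under eq_bigr => t _ do rewrite -mulr_sumr.
by rewrite -mulr_suml; field.
Qed.

Lemma depends_prod (I : eqType) (r : seq I) (D : I -> {set T})
    (f : I -> Omega -> R) B :
  {in r, forall i, depends (D i) (f i)} -> {in r, forall i, D i \subset B} ->
  depends B (fun t => \prod_(i <- r) f i t).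
Proof.
move=> fD DB t t' tt'; rewrite !big_seq; apply: eq_bigr => i ir.
by apply: (fD _ ir) => v vD; apply: tt'; apply: (subsetP (DB _ ir)).
Qed.

Lemma mean_prod_seq (I : finType) (r : seq I) (D : I -> {set T})
    (f : I -> Omega -> R) :
  uniq r -> {in r, forall i, depends (D i) (f i)} ->
  {in r &, forall i j, i != j -> [disjoint D i & D j]} ->
  mean (fun t => \prod_(i <- r) f i t) = \prod_(i <- r) mean (f i).
Proof.
elim: r => [|i r IH] /= => [_ _ _|/andP[ir ur] fD DD].
  by rewrite big_nil -[RHS](mean_cst 1); apply: eq_mean => t; rewrite big_nil.
rewrite big_cons -IH //; last 2 first.
- by move=> j jr; apply: fD; rewrite inE jr orbT.
- by move=> j j' jr jr'; apply: DD; rewrite inE ?jr ?jr' orbT.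
rewrite -(mean_mul_disjoint (A := D i) (B := \bigcup_(j in r) D j)).
- by apply: eq_mean => t; rewrite big_cons.
- by apply: fD; rewrite mem_head.
- apply: (@depends_prod _ _ D) => j jr; first by apply: fD; rewrite inE jr orbT.
  exact: (bigcup_sup j).
- rewrite disjoint_sym disjoint_subset; apply/subsetP => v.
  move=> /bigcupP[j jr vj]; rewrite inE.
  have ji : j != i by apply: contraNneq ir => <-.
  by rewrite (disjointFr (DD j i _ _ ji)) ?inE ?eqxx ?jr ?orbT.
Qed.

Lemma mean_prod (I : finType) (P : pred I) (D : I -> {set T})
    (f : I -> Omega -> R) :
  (forall i, P i -> depends (D i) (f i)) ->
  (forall i j, P i -> P j -> i != j -> [disjoint D i & D j]) ->
  mean (fun t => \prod_(i | P i) f i t) = \prod_(i | P i) mean (f i).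
Proof.
move=> fD DD; rewrite -big_filter -(@mean_prod_seq _ _ D).
- by apply: eq_mean => t; rewrite -big_filter.
- by rewrite filter_uniq ?index_enum_uniq.
- by move=> i; rewrite mem_filter => /andP[/fD].
- by move=> i j; rewrite !mem_filter => /andP[Pi _] /andP[Pj _]; apply: DD.
Qed.

(** Exchanging two values at the coordinate [v] permutes the sample space, so all values of [t v]
    are equally likely. *)
Lemma mean_coord (v : T) (s : S) : mean (fun t => (t v == s)%:R) = #|S|%:R^-1.
Proof.
have Sinv s' : mean (fun t => (t v == s')%:R) = mean (fun t => (t v == s)%:R).
  rewrite /mean; congr (_ / _).
  pose sg t : Omega := [ffun x => if x == v then tperm s s' (t x) else t x].
  have sgK : involutive sg.
    by move=> t; apply/ffunP => x; rewrite !ffunE; case: eqP => // _; rewrite tpermK.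
  rewrite (reindex_inj (inv_inj sgK)); apply: eq_bigr => t _.
  by rewrite ffunE eqxx (can2_eq (tpermK _ _) (tpermK _ _)) tpermR.
have S0 : #|S|%:R != 0 :> R by rewrite pnatr_eq0 -lt0n.
apply: (mulIf S0); rewrite mulVf // mulr_natr.
rewrite -sumr_const -(eq_bigr _ (fun s' _ => Sinv s')) -mean_sum.
rewrite -[RHS](mean_cst 1); apply: eq_mean => t.
rewrite (bigD1 (t v)) //= eqxx big1 ?addr0 // => s' ne.
by rewrite eq_sym (negbTE ne).
Qed.

End Independence.

(** * Walks with distinct consecutive classes *)

Section Walks.
Variables (T K : finType) (H : {set {set T}}) (c : {set T} -> K).
Local Open Scope nat_scope.
Implicit Types (gs : nat -> {set T}) (vs : nat -> T) (C : option K).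

(** Walks are total functions on [nat] of which only [gs i] for [i < L] and [vs i] for [i <= L]
    matter. Apart from the local conditions, edges and vertices may repeat. *)
Definition nbwalk L gs vs : Prop :=
  (forall i, i < L ->
     [/\ gs i \in H, vs i \in gs i, vs i.+1 \in gs i & vs i != vs i.+1]) /\
  (forall i, i.+1 < L -> c (gs i) != c (gs i.+1)).

Definition acyclic_upto M : Prop :=
  forall L gs vs, 0 < L <= M -> nbwalk L gs vs -> vs 0 != vs L.

Definition fcons X (x : X) (f : nat -> X) i := if i is i'.+1 then f i' else x.

Lemma nbwalk_cons e u L gs vs :
  nbwalk L gs vs -> e \in H -> u \in e -> vs 0 \in e -> u != vs 0 ->
  (0 < L -> c (gs 0) != c e) -> nbwalk L.+1 (fcons e gs) (fcons u vs).
Proof.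
move=> [w1 w2] eH ue ve uv ce; split=> [[|i] //= iL|[|i] //= iL]; first exact: w1.
  by rewrite eq_sym ce.
exact: w2.
Qed.

Lemma nbwalk_rev L gs vs :
  nbwalk L gs vs -> nbwalk L (fun i => gs (L.-1 - i)) (fun i => vs (L - i)).
Proof.
move=> [w1 w2]; split=> i iL.
  have /w1[? ? ? ?] : L.-1 - i < L by lia.
  have <- : (L.-1 - i).+1 = L - i by lia.
  by have <- : L.-1 - i = L - i.+1; [lia | rewrite eq_sym].
have -> : L.-1 - i = (L.-1 - i.+1).+1 by lia.
by rewrite eq_sym w2 //; lia.
Qed.

Lemma nbwalk_cat L1 gs1 vs1 L2 gs2 vs2 :
  nbwalk L1 gs1 vs1 -> nbwalk L2 gs2 vs2 -> vs1 L1 = vs2 0 ->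
  (0 < L1 -> 0 < L2 -> c (gs1 L1.-1) != c (gs2 0)) ->
  nbwalk (L1 + L2) (fun i => if i < L1 then gs1 i else gs2 (i - L1))
                   (fun i => if i < L1 then vs1 i else vs2 (i - L1)).
Proof.
move=> [w1 w1'] [w2 w2'] e12 c12; split=> i iL.
  case: (ltnP i L1) => iL1.
    have [? ? ? ?] := w1 _ iL1; case: ltnP => // iL1'.
    have E : i.+1 = L1 by lia.
    by have -> : i.+1 - L1 = 0; [lia | rewrite -e12 -E].
  rewrite ltnNge (leq_trans iL1 (leqnSn i)) /= subSn //.
  by apply: w2; lia.
case: (ltnP i L1) => iL1.
  case: ltnP => iL1'; first exact: w1'.
  have -> : i.+1 - L1 = 0 by lia.
  by have -> : i = L1.-1; [lia | apply: c12; lia].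
rewrite ltnNge (leq_trans iL1 (leqnSn i)) /= subSn //.
by apply: w2'; lia.
Qed.

(** The vertices reached from [u] by a walk of length at most [j] whose first class is not [C]; the
    decision [acc j u C] will depend on their rounds only. Passing on the class just used makes
    consecutive classes differ. *)
Fixpoint reach j u C : {set T} :=
  if j is j'.+1 then
    u |: \bigcup_(e in H | (u \in e) && (Some (c e) != C))
            \bigcup_(u' in e :\ u) reach j' u' (Some (c e))
  else [set u].

Definition branch j u (D : K) : {set T} :=
  \bigcup_(e in H | (u \in e) && (c e == D))
     \bigcup_(u' in e :\ u) reach j u' (Some D).

Lemma mem_reach j u C : u \in reach j u C.
Proof. by case: j => [|j]; rewrite /= !inE eqxx. Qed.

Lemma reachS j u C : reach j u C \subset reach j.+1 u C.
Proof.
elim: j u C => [|j IH] u C; first by rewrite /= subsetUl.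
rewrite [reach j.+2 u C]/= [reach j.+1 u C]/=.
apply: setUS; apply/bigcupsP => e eH; apply: (bigcup_max e) => //.
apply/bigcupsP => v ve; apply: (bigcup_max v) => //; exact: IH.
Qed.

Lemma branch_reach j u C D : Some D != C -> branch j u D \subset reach j.+1 u C.
Proof.
move=> DC; apply/bigcupsP => e /andP[eH /andP[ue /eqP ce]].
rewrite /= subsetU //; apply/orP; right.
by apply: (bigcup_max e); rewrite ?eH ?ue ?ce.
Qed.

Lemma reachP j u C y : y \in reach j u C ->
  exists L gs vs, [/\ L <= j, nbwalk L gs vs, vs 0 = u, vs L = y &
    0 < L -> Some (c (gs 0)) != C].
Proof.
have base u' C' y' : y' = u' -> exists L gs vs, [/\ L <= 0, nbwalk L gs vs,
    vs 0 = u', vs L = y' & 0 < L -> Some (c (gs 0)) != C'].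
  by move=> ->; exists 0, (fun=> set0), (fun=> u').
elim: j u C => [|j IH] u C /=; first by rewrite inE => /eqP /base.
rewrite !inE => /orP[/eqP/base|].
  by move=> /(_ C)[L [gs [vs [L0 ? ? ? ?]]]]; exists L, gs, vs; split=> //; lia.
case/bigcupP=> e /and3P[eH ue ce] /bigcupP[u']; rewrite !inE => /andP[u'u u'e].
case/IH=> L [gs [vs [Lj wk v0 vL cL]]].
exists L.+1, (fcons e gs), (fcons u vs); split=> //.
apply: nbwalk_cons; rewrite ?v0 // eq_sym //.
Qed.

Lemma branchP j u D y : y \in branch j u D ->
  exists L gs vs, [/\ 0 < L <= j.+1, nbwalk L gs vs, vs 0 = u, vs L = y &
    c (gs 0) = D].
Proof.
case/bigcupP=> e /and3P[eH ue /eqP ce] /bigcupP[u'].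
rewrite !inE => /andP[u'u u'e] /reachP[L [gs [vs [Lj wk v0 vL cL]]]].
exists L.+1, (fcons e gs), (fcons u vs); split=> //.
apply: nbwalk_cons; rewrite ?v0 // 1?eq_sym //.
by move=> /cL; rewrite ce; apply: contra => /eqP ->.
Qed.

(** The reversed first walk followed by the second is a closed walk of length [L1 + L2], since the
    classes at the junction differ. *)
Lemma nbwalk_meet M L1 gs1 vs1 L2 gs2 vs2 : acyclic_upto M ->
  nbwalk L1 gs1 vs1 -> nbwalk L2 gs2 vs2 -> vs1 0 = vs2 0 -> vs1 L1 = vs2 L2 ->
  0 < L1 + L2 <= M -> (0 < L1 -> 0 < L2 -> c (gs1 0) != c (gs2 0)) -> False.
Proof.
move=> ac w1 w2 e0 eL LM c12.
have := nbwalk_cat (nbwalk_rev w1) w2; rewrite /= !subnn => /(_ e0 c12) wk.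
have := ac _ _ _ LM wk; rewrite addKn subn0 [L1 + L2 < L1]ltnNge leq_addr /=.
case: (posnP L1) => [L10|_]; last by rewrite eL eqxx.
by rewrite sub0n -e0 -eL L10 eqxx.
Qed.

Variable M : nat.
Hypothesis ac : acyclic_upto M.

Lemma branch_disjoint j u D1 D2 : (j.+1).*2 <= M -> D1 != D2 ->
  [disjoint branch j u D1 & branch j u D2].
Proof.
move=> jM D12; apply/pred0P => y /=; apply/negP => /andP[].
move=> /branchP[L1 [gs1 [vs1 [? ? ? ? c1]]]] /branchP[L2 [gs2 [vs2 [? ? ? ? c2]]]].
apply: (@nbwalk_meet M L1 gs1 vs1 L2 gs2 vs2) => //; try congruence; lia.
Qed.

Lemma branch_root j u D : j.+1 <= M -> u \notin branch j u D.
Proof.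
move=> jM; apply/negP => /branchP[L [gs [vs [L0 wk v0 vL _]]]].
have LM : 0 < L <= M by lia.
by have := ac LM wk; rewrite v0 vL eqxx.
Qed.

Lemma reach_disjoint j e u1 u2 : (j.+1).*2 <= M -> e \in H ->
  u1 \in e -> u2 \in e -> u1 != u2 ->
  [disjoint reach j u1 (Some (c e)) & reach j u2 (Some (c e))].
Proof.
move=> jM eH u1e u2e u12; apply/pred0P => y /=; apply/negP => /andP[].
move=> /reachP[L1 [gs1 [vs1 [? ? v1 ? c1]]]] /reachP[L2 [gs2 [vs2 [? w2 v2 ? c2]]]].
(* Prefixing [e] makes the second walk start at [u1] too. Neither old walk starts with the class of
   [e], so the classes at both junctions differ. *)
have w2' : nbwalk L2.+1 (fcons e gs2) (fcons u1 vs2).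
  by apply: nbwalk_cons; rewrite ?v2 //= => /c2; apply: contra => /eqP ->.
apply: (@nbwalk_meet M L1 gs1 vs1 _ _ _ _ _ w2') => //=; try congruence; first lia.
by move=> /c1 cc _; apply: contra cc => /eqP ->.
Qed.

End Walks.

(** * The random greedy process *)

(** For [x <= 1/2], use [expR (2 x) >= 1 + 2 x] and [(1 + 2 x) (1 - x) >= 1]; for larger [x] the
    left side is below [1/2]. *)
Lemma one_sub_ge_expR (R : realType) (b x : R) :
  0 <= x -> b <= x -> b <= 2^-1 -> expR (- (2 * x)) <= 1 - b.
Proof.
move=> x0 bx b2; rewrite expRN; have ge1 := expR_ge1Dx (2 * x).
have [x2|x2] := lerP x 2^-1.
  apply: (@le_trans _ _ (1 + 2 * x)^-1).
    by rewrite lef_pV2 ?posrE ?expR_gt0 //; lra.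
  by rewrite -[leLHS]mul1r ler_pdivrMr; [nra|lra].
apply: (@le_trans _ _ 2^-1); last lra.
by rewrite lef_pV2 ?posrE ?expR_gt0 //; lra.
Qed.

Section Greedy.
Variables (R : realType) (T K : finType) (H : {set {set T}}).
Variables (c : {set T} -> K) (r Q : nat).
Hypothesis Q_ge : (20 <= Q)%N.
Hypothesis r_ge2 : (2 <= r)%N.
Hypothesis H_unif : {in H, forall e : {set T}, #|e| = r.+1}.
Hypothesis H_class : {in H &, forall e e' : {set T}, c e = c e' -> (r <= #|e :&: e'|)%N}.
Hypothesis H_ac : acyclic_upto H c Q.*2.

Local Notation Omega := {ffun T -> 'I_Q}.
Local Notation mean := (@mean R T 'I_Q).
Implicit Types (u v : T) (C : option K) (D : K) (t : Omega).

Let I_gt0 : (0 < #|'I_Q|)%N. Proof. by rewrite card_ord; lia. Qed.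

(** The acceptance predicate is a parameter because [acc] uses [blocked] in its own recursion.
    Treating every vertex of round [j] as accepted prevents several vertices of one round from
    completing an edge together. *)
Definition blocked (X : T -> option K -> Omega -> bool) j u D t :=
  [exists e in H, [&& u \in e, c e == D &
     [forall u' in e :\ u, X u' (Some D) t || (t u' == j :> nat)]]].

(** A round adds at most [1/Q] to the acceptance probability, so leaving room for [1/Q] keeps it at
    most [2/Q]. The condition is deterministic and creates no dependence between vertices. *)
Definition active (X : T -> option K -> Omega -> bool) u :=
  mean (fun t => (X u None t)%:R) + Q%:R^-1 <= 2 / Q%:R.

(* [acc j u (Some D) t] says that [u] is accepted before round [j] when the
   constraints of the class [D] are ignored at [u]; vertices are processed at
   the round [t u], and stop being accepted when their acceptance probability
   reaches the cap of [active]. *)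
Fixpoint acc j u C t : bool :=
  if j is i.+1 then
    acc i u C t || [&& t u == i :> nat, active (acc i) u &
      [forall D, (Some D != C) ==> ~~ blocked (acc i) i u D t]]
  else false.

Lemma acc_mono i j u C t : (i <= j)%N -> acc i u C t -> acc j u C t.
Proof.
move=> /subnK <-; elim: (j - i)%N => // m IH /IH a.
by rewrite addSn /= a.
Qed.

Lemma accP j u C t : acc j u C t ->
  [/\ (t u < j)%N, active (acc (t u)) u &
      forall D, Some D != C -> ~~ blocked (acc (t u)) (t u) u D t].
Proof.
elim: j => [//|j IH] /= /orP[/IH[]|/and3P[/eqP tj act /forallP nb]].
  by move=> tj ? ?; split=> //; exact: ltnW.
by rewrite tj; split=> // D; apply/implyP.
Qed.

Lemma acc_weaken j u C t : acc j u None t -> acc (t u).+1 u C t.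
Proof.
case/accP=> tj act nb /=; apply/orP; right; rewrite eqxx act /=.
by apply/forallP => D; rewrite nb ?implybT.
Qed.

(** In a fully accepted edge, a vertex of the latest round would have been blocked by the class of
    that edge. *)
Lemma acc_independent j e t : e \in H -> ~~ [forall u in e, acc j u None t].
Proof.
move=> eH; apply/negP => /forall_inP a.
have [v0 v0e] : exists v, v \in e by apply/card_gt0P; rewrite H_unif.
case: (@arg_maxnP _ v0 (mem e) (fun v => t v) v0e) => v ve vmax.
have {}ve : v \in e := ve.
have [_ _ /(_ (c e) isT)/negP] := accP (a v ve); apply.
apply/exists_inP; exists e => //; rewrite ve eqxx /=.
apply/forall_inP => u; rewrite !inE => /andP[uv ue].
have := vmax u ue; rewrite /= leq_eqVlt => /orP[->|lt]; first by rewrite orbT.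
by rewrite (acc_mono lt (acc_weaken _ (a u ue))).
Qed.

Lemma depends_blocked j u D :
  (forall u' C, depends (reach H c j u' C) (acc j u' C)) ->
  depends (branch H c j u D) (blocked (acc j) j u D).
Proof.
move=> dep t t' tt'; apply: eq_existsb => e; case eH: (e \in H) => //=.
case ue: (u \in e) => //=; case: eqP => //= ce.
apply: eq_forallb => u'.
case: (boolP (u' \in e :\ u)) => //= u'e.
have sub : {subset reach H c j u' (Some D) <= branch H c j u D}.
  move=> v vr; apply/bigcupP; exists e; first by rewrite eH ue ce eqxx.
  by apply/bigcupP; exists u'.
rewrite (dep u' (Some D) t t') => [|v /sub]; last exact: tt'.
by rewrite tt' // sub // mem_reach.
Qed.

Lemma depends_acc j u C : depends (reach H c j u C) (acc j u C).
Proof.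
elim: j u C => [//|j IH] u C t t' tt' /=.
rewrite (IH u C t t') => [|v /(subsetP (reachS _ _ _ _ _))]; last exact: tt'.
rewrite (tt' u) ?mem_reach //; congr (_ || [&& _, _ & _]).
apply: eq_forallb => D; case DC: (Some D != C) => //=; congr (~~ _).
apply: depends_blocked => // v /(subsetP (branch_reach _ _ _ _ DC)).
exact: tt'.
Qed.

Let pr j u C := mean (fun t => (acc j u C t)%:R).
Let beta j u D := mean (fun t => (blocked (acc j) j u D t)%:R).

(** Acceptance before round [j] forces [t u < j], so the two ways of being accepted exclude each
    other. In round [j], the blocking events of distinct classes read disjoint branches, none of
    which contains [u], so the probabilities multiply. *)
Lemma prS j u C : (j < Q)%N ->
  pr j.+1 u C = pr j u C + (active (acc j) u)%:R *
     (Q%:R^-1 * \prod_(D | Some D != C) (1 - beta j u D)).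
Proof.
move=> jQ; have jM : ((j.+1).*2 <= Q.*2)%N by rewrite leq_double.
pose fb D t : R := 1 - (blocked (acc j) j u D t)%:R.
have dfb D : depends (branch H c j u D) (fb D).
  apply: (depends_comp (fun b : bool => 1 - b%:R)).
  exact/depends_blocked/depends_acc.
have -> : \prod_(D | Some D != C) (1 - beta j u D) =
    mean (fun t => \prod_(D | Some D != C) fb D t).
  rewrite (@mean_prod _ _ _ I_gt0 _ _ (branch H c j u)).
  - by apply: eq_bigr => D _; rewrite meanB mean_cst.
  - by move=> D _; apply: dfb.
  - by move=> D1 D2 _ _; apply: (branch_disjoint H_ac).
have -> : Q%:R^-1 = mean (fun t => (t u == Ordinal jQ)%:R).
  by rewrite mean_coord // card_ord.
rewrite -(@mean_mul_disjoint _ _ _ I_gt0 [set u] (\bigcup_D branch H c j u D)).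
- rewrite -meanZ -meanD; apply: eq_mean => t /=.
  have -> : \prod_(D | Some D != C) fb D t =
      [forall D, (Some D != C) ==> ~~ blocked (acc j) j u D t]%:R.
    case: (boolP [forall D, _]) => [/forallP nb|].
      by rewrite big1 // => D DC; rewrite /fb (negbTE (implyP (nb D) DC)) subr0.
    case/forallPn=> D; rewrite negb_imply negbK => /andP[DC bl].
    by rewrite (bigD1 D) //= /fb bl subrr mul0r.
  rewrite -val_eqE /=.
  have [/accP[tj _ _]|_] /= := boolP (acc j u C t).
    by rewrite (ltn_eqF tj) /= mul0r mulr0 addr0.
  by rewrite add0r -!natrM !mulnb andbCA.
- by move=> t t' tt'; rewrite tt' ?inE.
- by move=> t t' tt'; apply: eq_bigr => D _; apply: dfb => v vD; apply: tt';
    apply/bigcupP; exists D.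
- rewrite disjoints1; apply/bigcupP => -[D _]; apply/negP.
  by apply: (branch_root H_ac); lia.
Qed.

(** * Blocking probabilities in a single round *)

Section Round.
Variables (j : nat) (u : T).
Hypothesis jQ : (j < Q)%N.
Hypothesis prj : forall v C, pr j v C <= 4 / Q%:R.
(** A vertex counts towards blocking if it was accepted earlier, with probability at most [4/Q], or
    has round [j], with probability [1/Q]. *)
Let z : R := 5 / Q%:R.
Let y v D t : R := (acc j v (Some D) t || (t v == j :> nat))%:R.

Lemma mean_y v D : mean (y v D) <= z.
Proof.
apply: (@le_trans _ _ (pr j v (Some D) + Q%:R^-1)); last first.
  by have := prj v (Some D); rewrite /z; lra.
have -> : Q%:R^-1 = mean (fun t => (t v == Ordinal jQ)%:R).
  by rewrite mean_coord // card_ord.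
rewrite -meanD; apply: le_mean => // t; rewrite /y -val_eqE /=.
by case: acc; case: eqP => _ /=; lra.
Qed.

Lemma mean_y_ge0 v D : 0 <= mean (y v D).
Proof. by apply: mean_ge0 => // t; rewrite ler0n. Qed.

(** Union bound over the edges of class [D] at [u]; in each of them the other [r] vertices have
    disjoint reaches and hence behave independently. *)
Lemma beta_le_degree D :
  beta j u D <= #|[set e in H | (u \in e) && (c e == D)]|%:R * z ^+ r.
Proof.
set E := [set e in H | _].
apply: (@le_trans _ _ (mean (fun t => \sum_(e in E) \prod_(v in e :\ u) y v D t))).
  apply: le_mean => // t; have pge0 e : 0 <= \prod_(v in e :\ u) y v D t.
    by apply: prodr_ge0 => v _; rewrite ler0n.
  case: (boolP (blocked _ _ _ _ _)) => [|_]; last by apply: sumr_ge0.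
  case/exists_inP=> e eH /and3P[ue ce /forall_inP all].
  have eE : e \in E by rewrite inE eH ue ce.
  rewrite (bigD1 e) //= [X in _ <= X + _]big1 ?lerDl ?sumr_ge0 // => v ve.
  by rewrite /y all.
rewrite mean_sum mulr_natl -sumr_const; apply: ler_sum => e.
rewrite inE => /and3P[eH ue /eqP ce].
rewrite (@mean_prod _ _ _ I_gt0 _ _ (fun v => reach H c j v (Some D))).
- rewrite -(_ : #|e :\ u| = r) -?prodr_const.
    by apply: ler_prod => v _; rewrite mean_y_ge0 mean_y.
  by have := cardsD1 u e; rewrite ue H_unif // => -[].
- move=> v _; move=> t t' tt'; rewrite /y (@depends_acc j v (Some D) t t') //.
  by rewrite (tt' v) ?mem_reach.
- move=> v w; rewrite !inE => /andP[_ ve] /andP[_ we] vw; rewrite -ce.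
  by apply: (reach_disjoint H_ac) => //; lia.
Qed.

(** Every edge of a class misses at most one vertex of a fixed edge [e0] of that class. So a
    blocking edge contains one of two chosen vertices [v], [w] of [e0], and [beta] is at most
    [2 z = 10/Q], however many edges the class has. *)
Lemma beta_le_half D : beta j u D <= 2^-1.
Proof.
have z4 : 2 * z <= 2^-1.
  have : 20%:R <= Q%:R :> R by rewrite ler_nat.
  by rewrite /z => ?; rewrite mulrA ler_pdivrMr; lra.
case: (pickP [pred e in H | (u \in e) && (c e == D)]) => [e0 /= | no]; last first.
  rewrite [beta _ _ _](_ : _ = 0); first lra.
  rewrite /beta -[RHS](mean_cst T I_gt0 0); apply: eq_mean => t.
  case: (boolP (blocked _ _ _ _ _)) => // /exists_inP[e eH /and3P[ue ce _]].
  by have := no e; rewrite /= eH ue ce.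
case/and3P=> e0H ue0 /eqP ce0.
have : (1 < #|e0 :\ u|)%N.
  by have := cardsD1 u e0; rewrite ue0 H_unif //; lia.
case/card_gt1P=> v [w [ve we vw]].
apply: le_trans z4; rewrite mulr_natl mulr2n.
apply: (@le_trans _ _ (mean (y v D) + mean (y w D))); last first.
  by rewrite lerD ?mean_y.
rewrite -meanD; apply: le_mean => // t.
case: (boolP (blocked _ _ _ _ _)) => [|_]; last by rewrite addr_ge0 ?ler0n.
case/exists_inP=> e eH /and3P[ue /eqP ce /forall_inP all].
have vw_e : (v \in e) || (w \in e).
  apply/norP => -[nv nw].
  have : (#|[set v; w]| <= #|e0 :\: e|)%N.
    apply: subset_leq_card; apply/subsetP => x; rewrite !inE.
    by move: ve we; rewrite !inE => /andP[_ ?] /andP[_ ?] /orP[]/eqP ->; rewrite ?nv ?nw.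
  have := H_class e0H eH; rewrite ce0 ce => /(_ erefl).
  rewrite cards2 vw /=; have := cardsID e e0; rewrite (H_unif e0H).
  by move: #|e0 :&: e| #|e0 :\: e| => a b; lia.
have yge0 x : 0 <= y x D t by rewrite ler0n.
have y1 x : x \in e0 :\ u -> x \in e -> y x D t = 1.
  move=> xe0 xe; rewrite /y all // !inE xe.
  by move: xe0; rewrite !inE andbT => /andP[].
case/orP: vw_e => [/(y1 _ ve)|/(y1 _ we)] ->; rewrite /=.
  by rewrite lerDl.
by rewrite lerDr.
Qed.

(** The degrees of [u] into the single classes add up to its degree, and so do the exponents from
    [one_sub_ge_expR]. *)
Lemma prod_one_sub_beta (d : R) : #|[set e in H | u \in e]|%:R <= d ->
  expR (- (2 * d * z ^+ r)) <= \prod_D (1 - beta j u D).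
Proof.
move=> deg; pose dD D := #|[set e in H | (u \in e) && (c e == D)]|.
have z0 : 0 <= z ^+ r by rewrite exprn_ge0 // divr_ge0 ?ler0n.
have degE : #|[set e in H | u \in e]| = (\sum_D dD D)%N.
  rewrite -sum1_card (partition_big c xpredT) //=; apply: eq_bigr => D _.
  by rewrite /dD -sum1_card; apply: eq_bigl => e; rewrite !inE andbA.
rewrite degE in deg.
apply: (@le_trans _ _ (expR (\sum_D (- (2 * ((dD D)%:R * z ^+ r)))))).
  rewrite ler_expR sumrN lerN2 -mulr_sumr -mulr_suml mulrA -natr_sum.
  by rewrite ler_wpM2r // ler_wpM2l.
rewrite expR_sum; apply: ler_prod => D _; rewrite expR_ge0 /=.
by apply: one_sub_ge_expR; rewrite ?mulr_ge0 ?beta_le_degree ?beta_le_half.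
Qed.

(** Ignoring a class removes one factor [1 - beta >= 1/2], which at most doubles the increment. *)
Lemma pr_le2 C : pr j u C <= 2 * pr j u None ->
  pr j.+1 u C <= 2 * pr j.+1 u None.
Proof.
move=> IH; rewrite !prS // mulrDr lerD // [leRHS]mulrCA ler_wpM2l // [leRHS]mulrCA.
rewrite ler_wpM2l ?invr_ge0 //.
have b2 D : 2^-1 <= 1 - beta j u D by have := beta_le_half D; lra.
have b0 D : 0 <= 1 - beta j u D by apply: le_trans (b2 D); lra.
case: C {IH} => [D0|]; last by rewrite ler_peMl ?ler1n ?prodr_ge0.
rewrite [X in _ <= _ * X](bigD1 D0) //= mulrA.
rewrite ler_peMl ?prodr_ge0 //; by have := b2 D0; lra.
Qed.

End Round.

(** Simultaneous induction: together the two bounds give the [4/Q] that the lemmas on a single round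
    require. *)
Lemma pr_bounds j u : (j <= Q)%N ->
  pr j u None <= 2 / Q%:R /\ forall C, pr j u C <= 2 * pr j u None.
Proof.
elim: j u => [|j IH] u jQ.
  have pr0 C : pr 0 u C = 0 by rewrite -[RHS](mean_cst T I_gt0 0).
  by rewrite pr0; split=> [|C]; rewrite ?pr0 ?mulr0 // divr_ge0 ?ler0n.
have {}IH v := IH v (ltnW jQ).
have prj v C : pr j v C <= 4 / Q%:R.
  have [h1 h2] := IH v; apply: le_trans (h2 C) _.
  by have -> : 4 / Q%:R = 2 * (2 / Q%:R) :> R; [ring | rewrite ler_pM2l].
split=> [|C]; last by apply: pr_le2 => //; case: (IH u).
rewrite prS //; case: (boolP (active _ _)) => [act|_]; last first.
  by rewrite mul0r addr0; case: (IH u).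
rewrite mul1r; apply: le_trans act; rewrite lerD2l.
rewrite ler_piMr ?invr_ge0 //; apply: prodr_ile1 => D _.
rewrite subr_ge0 (le_trans (beta_le_half _ jQ prj _)) /=; last lra.
by rewrite gerBl; apply: mean_ge0 => // t; rewrite ler0n.
Qed.

(** Once [u] is inactive its probability exceeds [1/Q]. Otherwise every round adds at least [q/Q],
    with [q] the exponential, and [Q] rounds would give [q > 2/Q], above the cap. *)
Lemma pr_final (d : R) u : #|[set e in H | u \in e]|%:R <= d ->
  2 < Q%:R * expR (- (2 * d * (5 / Q%:R) ^+ r)) -> Q%:R^-1 <= pr Q u None.
Proof.
set q := expR _ => deg hq.
have Q0 : 0 < Q%:R :> R by rewrite ltr0n; lia.
have prj j v C : (j <= Q)%N -> pr j v C <= 4 / Q%:R.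
  move=> jQ; have [h1 h2] := pr_bounds v jQ; apply: le_trans (h2 C) _.
  by have -> : 4 / Q%:R = 2 * (2 / Q%:R) :> R; [ring | rewrite ler_pM2l].
have prod_ge j : (j < Q)%N -> q <= \prod_(D | Some D != None) (1 - beta j u D).
  by move=> jQ; apply: prod_one_sub_beta => // v C; apply: prj; exact: ltnW.
suff main j : (j <= Q)%N ->
    Q%:R^-1 <= pr j u None \/ j%:R * (Q%:R^-1 * q) <= pr j u None.
  case: (main Q (leqnn Q)) => // h; exfalso.
  have [] := pr_bounds u (leqnn Q); rewrite leNgt => /negP + _; apply.
  apply: lt_le_trans h; rewrite mulrA mulfV ?gt_eqF // mul1r.
  by rewrite ltr_pdivrMr // mulrC.
elim: j => [|j IH] jQ.
  by right; rewrite mul0r mean_ge0 // => t; rewrite ler0n.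
have step : 0 <= (active (acc j) u)%:R *
     (Q%:R^-1 * \prod_(D | Some D != None) (1 - beta j u D)).
  rewrite !mulr_ge0 ?ler0n ?invr_ge0 ?ler0n //.
  by apply: le_trans (prod_ge _ jQ); exact: expR_ge0.
rewrite prS //; case: (IH (ltnW jQ)) => h.
  by left; rewrite (le_trans h) // lerDl.
case: (boolP (active (acc j) u)) step => [_ _|]; last first.
  rewrite -ltNge => nact _; left; rewrite mul0r addr0.
  by rewrite -/(pr j u None) in nact; rewrite ltW //; move: nact; lra.
right; rewrite mul1r -natr1 mulrDl mul1r lerD // ler_wpM2l ?invr_ge0 ?ler0n //.
exact: prod_ge.
Qed.

Lemma greedy_independent (d : R) (A : {set T}) :
  (forall u, u \in A -> #|[set e in H | u \in e]|%:R <= d) ->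
  2 < Q%:R * expR (- (2 * d * (5 / Q%:R) ^+ r)) ->
  exists I : {set T}, [/\ I \subset A, {in H, forall e : {set T}, ~~ (e \subset I)} &
    (#|A| <= Q * #|I|)%N].
Proof.
move=> deg hq; have Q0 : 0 < Q%:R :> R by rewrite ltr0n; lia.
pose I t := [set u in A | acc Q u None t].
have [t ht] := mean_le_exists I_gt0 (fun t => #|I t|%:R : R).
exists (I t); split.
- by apply/subsetP => u; rewrite inE => /andP[].
- move=> e eH; apply: contra (acc_independent Q t eH) => /subsetP eI.
  by apply/forall_inP => u /eI; rewrite inE => /andP[].
rewrite -(ler_nat R) natrM -ler_pdivrMl //; apply: le_trans ht.
rewrite (@eq_mean _ _ _ _ (fun t => \sum_(u in A) (acc Q u None t)%:R)); last first.
  move=> t'; rewrite -natr_sum -sum1_card big_mkcond [in RHS]big_mkcond /=.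
  congr (_%:R); apply: eq_bigr => u _; rewrite inE.
  by case: (u \in A) => //=; case: acc.
rewrite mean_sum mulr_natr -sumr_const; apply: ler_sum => u uA.
exact: pr_final (deg u uA) hq.
Qed.

End Greedy.

(** * Acyclicity from the absence of small dense unions *)

Section Growth.
Variables (T : finType) (H : {set {set T}}) (k : nat).
Local Open Scope nat_scope.

Definition glue (P : pred nat) (F : {set {set T}}) : {set {set T}} :=
  [set W :|: e | W in F, e in H & P #|e :&: W|].

(** Attaching an edge in [1] or [k - 1] vertices raises the expected number of such unions in the
    sample by a moderate factor only ([growth_sum]); the attachments in between, used by [close],
    make it much smaller ([closing_sum]). *)
Definition grow j := iter j (glue [pred i | (i == 1) || (i == k.-1)]) H.

Definition close j := glue [pred i | 2 <= i <= k - 2] (grow j).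

End Growth.

Section Clean.
Variables (T K : finType) (H : {set {set T}}) (c : {set T} -> K).
Variables (k M : nat) (A : {set T}).
Local Open Scope nat_scope.
Hypothesis k_ge4 : 4 <= k.
Hypothesis H_unif : {in H, forall e : {set T}, #|e| = k}.
Hypothesis H_diff :
  {in H &, forall e e' : {set T}, c e != c e' -> #|e :&: e'| <= k - 3}.
Hypothesis H_same :
  {in H &, forall e e' : {set T}, c e = c e' -> e :&: e' != set0}.
Hypothesis A_clean : forall j X, j < M -> X \in close H k j -> ~~ (X \subset A).

Let HA := [set e in H | e \subset A].
Let cup (s : seq {set T}) := \bigcup_(e <- s) e.

Fixpoint conn (s : seq {set T}) : bool :=
  if s is e :: s' then (s' == [::]) || (e :&: cup s' != set0) && conn s'
  else true.

Lemma cup_cons e s : cup (e :: s) = e :|: cup s.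
Proof. by rewrite /cup big_cons. Qed.

Lemma cup_subA s : {subset s <= HA} -> cup s \subset A.
Proof.
elim: s => [|e s IH] sH; first by rewrite /cup big_nil sub0set.
rewrite cup_cons subUset IH ?andbT; last by move=> x xs; apply: sH; rewrite inE xs orbT.
by have := sH e (mem_head _ _); rewrite inE => /andP[].
Qed.

Lemma not_close j W g : j < M -> W \in grow H k j -> W \subset A -> g \in HA ->
  ~~ (2 <= #|g :&: W| <= k - 2).
Proof.
move=> jM Wj WA; rewrite inE => /andP[gH gA]; apply/negP => h.
have /(A_clean jM) : W :|: g \in close H k j.
  by apply/imset2P; exists W g => //; rewrite inE gH.
by rewrite subUset WA gA.
Qed.

(** Inside a clean set, an edge meeting a growing union does so in [1], [k - 1] or [k] vertices. In
    the last case the union does not change, so [j] is only bounded by the length. *)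
Lemma conn_grow s : {subset s <= HA} -> conn s -> 0 < size s <= M ->
  exists2 j, j < size s & cup s \in grow H k j.
Proof.
elim: s => // e s IH sH /= cs sM.
have eHA := sH e (mem_head _ _).
have eH : e \in H by move: eHA; rewrite inE => /andP[].
have {}sH : {subset s <= HA} by move=> x xs; apply: sH; rewrite inE xs orbT.
case: (posnP (size s)) => [/size0nil s0|s_gt0].
  by exists 0; rewrite // s0 /cup big_seq1.
have {cs} : (e :&: cup s != set0) && conn s by case: s s_gt0 cs {IH sM sH}.
rewrite -card_gt0 => /andP[e_gt0 cs].
have [|j js Wj] := IH sH cs; first by rewrite s_gt0 ltnW.
have jM : j < M by apply: leq_trans js (ltnW sM).
have := not_close jM Wj (cup_subA sH) eHA.
have := subset_leq_card (subsetIl e (cup s)); rewrite (H_unif eH) => le_k nc.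
case: (eqVneq #|e :&: cup s| k) => [eqk|nek].
  exists j; first exact: ltnW.
  have /eqP <- : e :&: cup s == e by rewrite eqEcard subsetIl eqk (H_unif eH) /=.
  by rewrite cup_cons; move: Wj; have /setUidPr -> : e :&: cup s \subset cup s
     by rewrite subsetIr.
exists j.+1 => //; rewrite cup_cons /grow iterS setUC.
apply/imset2P; exists (cup s) e => //; rewrite inE eH /=; move: nc nek; lia.
Qed.

(* The first time that the growing union meets [g] twice, it meets it in at most
   [1 + (k - 3)] vertices. *)
Lemma new_class s g : {subset s <= HA} -> conn s -> size s <= M -> g \in HA ->
  {in s, forall e, c e != c g} -> #|g :&: cup s| <= 1.
Proof.
elim: s => [|e s IH] sH cs sM gHA sg; first by rewrite /cup big_nil setI0 cards0.
have eHA := sH e (mem_head _ _).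
have eH : e \in H by move: eHA; rewrite inE => /andP[].
have gH : g \in H by move: gHA; rewrite inE => /andP[].
have [j js Wj] := conn_grow sH cs sM.
have jM : j < M := leq_trans js sM.
have := not_close jM Wj (cup_subA sH) gHA.
have cs' : conn s by move: cs => /= /orP[/eqP ->|/andP[]].
have h1 : #|g :&: cup s| <= 1.
  apply: IH => //; try by move=> x xs; (apply: sH || apply: sg); rewrite inE xs orbT.
  exact: ltnW.
have h2 : #|g :&: e| <= k - 3.
  by apply: H_diff => //; rewrite eq_sym sg ?mem_head.
have h3 : #|g :&: cup (e :: s)| <= #|g :&: e| + #|g :&: cup s|.
  by rewrite cup_cons setIUr cardsU leq_subr.
move: h1 h2 h3; move: (#|g :&: cup s|) (#|g :&: e|) (#|_|) => x y z; lia.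
Qed.

Fixpoint chain (gs : nat -> {set T}) i m b :=
  if m is m'.+1 then gs (i + m') :: chain gs i m' b else b.

Lemma mem_chain gs i m b e : e \in chain gs i m b ->
  e \in b \/ exists2 j, i <= j < i + m & e = gs j.
Proof.
elim: m => [|m IH] /=; first by left.
rewrite inE => /orP[/eqP ->|/IH[|[j jm ->]]]; last 2 first.
- by left.
- by right; exists j => //; lia.
by right; exists (i + m) => //; lia.
Qed.

Lemma size_chain gs i m b : size (chain gs i m b) = m + size b.
Proof. by elim: m => //= m ->. Qed.

Lemma sub_cup_chain gs i m b : cup b \subset cup (chain gs i m b).
Proof.
elim: m => //= m IH; rewrite cup_cons; apply: subset_trans IH _.
exact: subsetUr.
Qed.

Lemma chain_conn L gs vs i m b : nbwalk HA c L gs vs -> i + m <= L ->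
  conn b -> vs i \in cup b ->
  conn (chain gs i m b) /\ vs (i + m) \in cup (chain gs i m b).
Proof.
move=> [w _] + cb vb; elim: m => [|m IH] iL /=; first by rewrite addn0.
have [|cm vm] := IH; first by lia.
have /w[_ v1 v2 _] : i + m < L by lia.
split; last by rewrite cup_cons addnS inE v2.
apply/orP; right; rewrite cm andbT; apply/set0Pn; exists (vs (i + m)).
by rewrite inE v1.
Qed.

Lemma twice_in (g : {set T}) s v w : v \in g -> w \in g -> v != w ->
  v \in cup s -> w \in cup s -> 1 < #|g :&: cup s|.
Proof.
by move=> vg wg vw vs ws; apply/card_gt1P; exists v, w; rewrite !inE vg wg vs ws.
Qed.

(** Induction on [j - i]. If [gs i] and [gs j] had the same class they would meet, so these two and
    the edges from [gs i.+1] to [gs (j - 2)] form a connected list. The edge [gs (j - 1)] meets its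
    union in two vertices but by induction differs in class from all its members, against
    [new_class]. *)
Lemma nbwalk_classes L gs vs i j : nbwalk HA c L gs vs -> L <= M ->
  i < j -> j < L -> c (gs i) != c (gs j).
Proof.
move=> wk LM; have [m] := ubnP (j - i).
elim: m i j => // m IH i j jim ij jL.
case: (eqVneq j i.+1) => [j_eq|j_ne].
  by rewrite j_eq; case: wk => _; apply; rewrite -j_eq.
apply/negP => /eqP cij; case: (wk) => w _.
have gsHA l : l < L -> gs l \in HA by move=> /w[].
have gsH l : l < L -> gs l \in H by move=> /gsHA; rewrite inE => /andP[].
pose s := chain gs i.+1 (j - i.+2) [:: gs j; gs i].
have [|||cs vs_s] := @chain_conn L gs vs i.+1 (j - i.+2) [:: gs j; gs i] wk.
- lia.
- rewrite /= /cup big_seq1 andbT; apply: H_same; rewrite ?gsH //; try lia.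
- have /w[_ _ v2 _] : i < L by lia.
  by rewrite !cup_cons !inE v2 orbT.
have e1 : i.+1 + (j - i.+2) = j.-1 by lia.
have /w[gj vj1 vj2 vne] : j.-1 < L by lia.
have e2 : j.-1.+1 = j by lia.
rewrite e1 in vs_s; rewrite e2 in vj2 vne.
suff : #|gs j.-1 :&: cup s| <= 1.
  rewrite leqNgt (twice_in vj1 vj2 vne) //.
  apply: (subsetP (sub_cup_chain _ _ _ _)).
  by have /w[_ v1 _ _] := jL; rewrite cup_cons inE v1.
apply: new_class => //.
- move=> e /mem_chain[|[l lj ->]]; last by apply: gsHA; lia.
  by rewrite in_cons mem_seq1 => /orP[]/eqP ->; apply: gsHA; lia.
- by rewrite /s size_chain /=; lia.
- move=> e /mem_chain[|[l lj ->]]; last by apply: IH; lia.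
  rewrite !inE => /orP[]/eqP ->; last by apply: IH; lia.
  by rewrite eq_sym; apply: IH; lia.
Qed.

(** The last edge of a closed walk meets the union of the earlier ones at both of its walk vertices,
    against [new_class]. *)
Lemma clean_acyclic : acyclic_upto HA c M.
Proof.
move=> L gs vs LM wk; case: (wk) => w _; apply/eqP => v0L.
have gsHA l : l < L -> gs l \in HA by move=> /w[].
have [L1|L2] : L = 1 \/ 2 <= L by lia.
  by have /w[_ _ _] : 0 < L; [lia | rewrite v0L L1 eqxx].
pose s := chain gs 1 (L - 2) [:: gs 0].
have [|||cs vs_s] := @chain_conn L gs vs 1 (L - 2) [:: gs 0] wk.
- lia.
- by [].
- have /w[_ _ v1 _] : 0 < L by lia.
  by rewrite /cup big_seq1.
have e1 : 1 + (L - 2) = L.-1 by lia.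
have /w[gj vj1 vj2 vne] : L.-1 < L by lia.
have e2 : L.-1.+1 = L by lia.
rewrite e1 in vs_s; rewrite e2 in vj2 vne.
suff : #|gs L.-1 :&: cup s| <= 1.
  rewrite leqNgt (twice_in vj1 vj2 vne) //.
  apply: (subsetP (sub_cup_chain _ _ _ _)); rewrite -v0L.
  by have /w[_ v1 _ _] : 0 < L; [lia | rewrite /cup big_seq1].
apply: new_class => //.
- move=> e /mem_chain[|[l lj ->]]; last by apply: gsHA; lia.
  by rewrite mem_seq1 => /eqP ->; apply: gsHA; lia.
- by rewrite /s size_chain /=; lia.
- move=> e /mem_chain[|[l lj ->]].
    by rewrite inE => /eqP ->; apply: (nbwalk_classes wk); lia.
  by apply: (nbwalk_classes wk); lia.
Qed.

End Clean.

(** * Sampling and counting *)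

Section Sampling.
Variables (R : realType) (T : finType) (p : R).
Hypothesis p_ge0 : 0 <= p.
Hypothesis p_le1 : p <= 1.
Implicit Types (J W : {set T}).

(** The probability that a random set, containing each vertex independently with probability [p],
    equals [J]. *)
Definition sample_weight J : R := \prod_i (if i \in J then p else 1 - p).

Lemma sum_sample_weight W :
  \sum_J sample_weight J * (W \subset J)%:R = p ^+ #|W|.
Proof.
transitivity (\prod_i (p + (1 - p) * (i \notin W)%:R)); last first.
  rewrite -prodr_const [RHS]big_mkcond; apply: eq_bigr => i _.
  by case: (i \in W) => /=; ring.
rewrite bigA_distr; apply: eq_bigr => J _.
have -> : (W \subset J)%:R = \prod_i (if i \in J then 1 else (i \notin W)%:R) :> R.
  case: (boolP (W \subset J)) => [/subsetP WJ|/subsetPn[i iW iJ]].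
    rewrite big1 // => i _; case: ifP => // iJ.
    by rewrite (contraFN (WJ i)).
  by rewrite (bigD1 i) //= (negbTE iJ) iW mul0r.
by rewrite -big_split; apply: eq_bigr => i _; case: ifP => //=; rewrite mulr1.
Qed.

Lemma sample_le_exists (f : {set T} -> R) :
  exists J, \sum_J sample_weight J * f J <= f J.
Proof.
set m := \sum_J _.
have [/existsP[J hJ]|/existsPn hJ] := boolP [exists J, m <= f J]; first by exists J.
have w0 J : 0 <= sample_weight J.
  by apply: prodr_ge0 => i _; case: ifP => _ //; rewrite subr_ge0.
have w1 : \sum_J sample_weight J = 1.
  rewrite -[RHS](expr0 p) -(cards0 T) -(sum_sample_weight set0).
  by apply: eq_bigr => J _; rewrite sub0set mulr1.
suff : m < m by rewrite ltxx.
have [J0 J0_gt0] : exists J, 0 < sample_weight J.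
  apply/existsP; apply: contraT => /existsPn h.
  suff : (1 : R) <= 0 by rewrite ler10.
  by rewrite -w1 sumr_le0 // => J _; rewrite leNgt h.
have mE : m = \sum_J sample_weight J * m by rewrite -mulr_suml w1 mul1r.
rewrite [ltRHS]mE [ltLHS](bigD1 J0) //= [ltRHS](bigD1 J0) //= ltr_leD //.
  by rewrite ltr_pM2l // ltNge hJ.
by apply: ler_sum => J _; rewrite ler_wpM2l // ltW // ltNge hJ.
Qed.

Lemma hitting_set (F : {set {set T}}) : set0 \notin F ->
  exists2 B : {set T}, (#|B| <= #|F|)%N & {in F, forall W, W :&: B != set0}.
Proof.
move=> F0; exists [set x in pmap (fun W : {set T} => [pick x in W]) (enum F)].
  rewrite cardsE (leq_trans (card_size _)) // size_pmap.
  by rewrite cardE count_size.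
move=> W WF; apply/set0Pn.
have : [pick x in W] != None.
  case: pickP => // W0; case/negP: F0; suff -> : set0 = W by [].
  by apply/setP => x; rewrite inE (W0 x).
case E : [pick x in W] => [x|] // _; exists x; rewrite !inE mem_pmap.
apply/andP; split; first by move: E; case: pickP => // y yW [<-].
by apply/mapP; exists W; rewrite ?mem_enum // E.
Qed.

(* First-moment deletion: remove a vertex of every member of [F] and all the
   vertices of large degree from a random sample. *)
Lemma sample_deletion (k : nat) (H F : {set {set T}}) (d : R) :
  0 < d -> {in H, forall e : {set T}, #|e| = k} -> set0 \notin F ->
  exists A : {set T}, [/\ {in F, forall W : {set T}, ~~ (W \subset A)},
    {in A, forall v, #|[set e in [set e in H | e \subset A] | v \in e]|%:R <= d} &
    p * #|T|%:R - \sum_(W in F) p ^+ #|W| - k%:R / d * (#|H|%:R * p ^+ k)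
      <= #|A|%:R].
Proof.
move=> d0 Hk F0.
pose FJ J := [set W in F | W \subset J]; pose HJ J := [set e in H | e \subset J].
(* A lower bound for what survives the deletion: one vertex is removed per member of [F] inside [J],
   and by double counting at most [k / d] times the number of edges inside [J] are removed for their
   degree. *)
pose f J : R := #|J|%:R - #|FJ J|%:R - k%:R / d * #|HJ J|%:R.
have [J hJ] := sample_le_exists f; move: hJ; rewrite /f.
have cardJ (G : {set {set T}}) J' :
    #|[set W in G | W \subset J']|%:R = \sum_(W in G) (W \subset J')%:R :> R.
  rewrite -sum1_card natr_sum big_mkcond [RHS]big_mkcond /=.
  by apply: eq_bigr => W _; rewrite inE; case: (W \in G) => //=; case: (W \subset J').
have meanJ (G : {set {set T}}) :
    \sum_J sample_weight J * #|[set W in G | W \subset J]|%:R =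
    \sum_(W in G) p ^+ #|W|.
  under eq_bigr => J' _ do rewrite cardJ mulr_sumr.
  by rewrite exchange_big; apply: eq_bigr => W _; rewrite sum_sample_weight.
have -> : \sum_J sample_weight J *
    (#|J|%:R - #|FJ J|%:R - k%:R / d * #|HJ J|%:R) =
    p * #|T|%:R - \sum_(W in F) p ^+ #|W| - k%:R / d * (#|H|%:R * p ^+ k).
  under eq_bigr => J' _ do rewrite !mulrBr [_ * (_ / _ * _)]mulrCA.
  rewrite !big_split /= !sumrN meanJ -mulr_sumr meanJ; congr (_ - _ - _).
    rewrite (eq_bigr (fun J => \sum_v sample_weight J * ([set v] \subset J)%:R)).
      rewrite exchange_big /= mulr_natr -sumr_const; apply: eq_bigr => v _.
      by rewrite sum_sample_weight cards1 expr1.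
    move=> J' _; rewrite -mulr_sumr -sum1_card natr_sum big_mkcond; congr (_ * _).
    by apply: eq_bigr => v _; rewrite sub1set; case: ifP.
  congr (_ * _); rewrite mulr_natl -sumr_const; apply: eq_bigr => e eH.
  by rewrite Hk.
move=> hJ.
have [|B1 B1F hit] := @hitting_set (FJ J); first by rewrite inE (negbTE F0).
pose deg v := #|[set e in HJ J | v \in e]|.
pose B2 := [set v | d < (deg v)%:R].
have B2d : #|B2|%:R <= k%:R / d * #|HJ J|%:R.
  rewrite mulrAC ler_pdivlMr // mulr_natl -sumr_const.
  apply: (@le_trans _ _ (\sum_(v in B2) (deg v)%:R)).
    by apply: ler_sum => v; rewrite inE => /ltW.
  rewrite -natr_sum -natrM ler_nat.
  apply: (@leq_trans (\sum_v deg v)%N).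
    by rewrite [leqRHS](bigID (mem B2)) /=; exact: leq_addr.
  under eq_bigr => v _ do rewrite /deg -sum1_card.
  rewrite (eq_bigr (fun v => \sum_(e in HJ J) (v \in e))%N); last first.
    move=> v _; rewrite big_mkcond [RHS]big_mkcond; apply: eq_bigr => e _.
    by rewrite !inE; case: (e \in H) => //; case: (e \subset J) => //=;
      case: (v \in e).
  rewrite exchange_big /= mulnC -sum_nat_const; apply: leq_sum => e eH.
  have /Hk <- : e \in H by move: eH; rewrite inE => /andP[].
  rewrite -sum1_card [leqRHS]big_mkcond; apply: leq_sum => v _.
  by case: (v \in e).
exists (J :\: B1 :\: B2); split.
- move=> W WF; apply/negP => WA.
  have WJ : W \in FJ J.
    rewrite inE WF (subset_trans WA) // (subset_trans (subsetDl _ _)) //.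
    exact: subsetDl.
  case/set0Pn: (hit W WJ) => x; rewrite inE => /andP[/(subsetP WA)].
  by rewrite !inE => /and3P[_ /negP].
- move=> v; rewrite !inE => /and3P[nB _ _]; rewrite leNgt; apply: contra nB.
  move/lt_le_trans; apply; rewrite ler_nat; apply: subset_leq_card.
  apply/subsetP => e; rewrite !inE => /andP[/andP[-> eA] ->]; rewrite andbT /=.
  by rewrite (subset_trans eA) // (subset_trans (subsetDl _ _)) // subsetDl.
apply: le_trans hJ _.
have h1 : (#|J| <= #|J :\: B1 :\: B2| + #|B1| + #|B2|)%N.
  rewrite -(cardsID B1 J) -(cardsID B2 (J :\: B1)).
  have := subset_leq_card (subsetIr J B1).
  have := subset_leq_card (subsetIr (J :\: B1) B2).
  move: #|J :&: B1| #|J :\: B1 :&: B2| #|J :\: B1 :\: B2| => x y z; lia.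
have h1' : #|J|%:R <= #|J :\: B1 :\: B2|%:R + #|B1|%:R + #|B2|%:R :> R.
  by rewrite -!natrD ler_nat.
have h2 : #|B1|%:R <= #|FJ J|%:R :> R by rewrite ler_nat.
move: h1' h2 B2d; lra.
Qed.

End Sampling.

(** * Classes and codegrees in an omitting system *)

Lemma leq_bin_exp n m : ('C(n, m) <= n ^ m)%N.
Proof.
apply: (@leq_trans (n ^_ m)); first by rewrite -bin_ffact leq_pmulr ?fact_gt0.
by elim: m => // m IH; rewrite ffactnSr expnSr leq_mul // leq_subr.
Qed.

Lemma exists_subset_card (T : finType) (A B : {set T}) m :
  A \subset B -> (#|A| <= m <= #|B|)%N ->
  exists S : {set T}, [/\ A \subset S, S \subset B & #|S| = m].
Proof.
move=> AB /andP[]; elim: m => [|m IH].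
  by rewrite leqn0 cards_eq0 => /eqP -> _; exists set0; rewrite !sub0set cards0.
rewrite leq_eqVlt => /orP[/eqP Am|Am] mB.
  by exists A; rewrite AB.
have [S [AS SB Sm]] := IH Am (ltnW mB).
have /set0Pn[x] : B :\: S != set0.
  by rewrite -card_gt0 cardsD (setIidPr SB) Sm subn_gt0.
rewrite inE => /andP[xS xB]; exists (x |: S); split.
- exact: subset_trans AS (subsetUr _ _).
- by rewrite subUset sub1set xB.
- by rewrite cardsU1 xS Sm.
Qed.

Section Omitting.
Variables (T : finType) (H : {set {set T}}) (k : nat).
Local Open Scope nat_scope.
Hypothesis k_ge4 : 4 <= k.
Hypothesis H_unif : {in H, forall e : {set T}, #|e| = k}.
Hypothesis H_omit :
  {in H &, forall e e' : {set T}, e != e' -> #|e :&: e'| != k - 2}.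
Implicit Types e f : {set T}.

Lemma omit_meet : {in H &, forall e f, k - 2 <= #|e :&: f| -> k - 1 <= #|e :&: f|}.
Proof.
move=> e f eH fH ef; have [<-|ne] := eqVneq e f.
  by rewrite setIid H_unif //; lia.
have := H_omit eH fH ne; lia.
Qed.

(** Both [e :&: f] and [f :&: h] miss at most one of the [k] vertices of [f], so they share at least
    [k - 2]. *)
Lemma omit_trans : {in H & &, forall e f h, k - 2 <= #|e :&: f| ->
  k - 2 <= #|f :&: h| -> k - 2 <= #|e :&: h|}.
Proof.
move=> e f h eH fH hH /(omit_meet eH fH) ef /(omit_meet fH hH) fh.
have : #|(e :&: f) :|: (f :&: h)| <= k.
  by rewrite -(H_unif fH) subset_leq_card // subUset subsetIr subsetIl.
have : #|(e :&: f) :&: (f :&: h)| <= #|e :&: h|.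
  by apply: subset_leq_card; apply/subsetP => x; rewrite !inE => /andP[/andP[-> _] /andP[_]].
have := cardsUI (e :&: f) (f :&: h).
move: ef fh; move: #|e :&: f| #|f :&: h| #|e :&: h| #|_ :|: _| #|_ :&: _| => a b c x y.
lia.
Qed.

(** The equivalence class itself serves as the label of the edge. *)
Definition cls e := [set f in H | k - 2 <= #|e :&: f|].

Lemma cls_refl e : e \in H -> e \in cls e.
Proof. by move=> eH; rewrite inE eH setIid H_unif //; lia. Qed.

Lemma cls_meet : {in H &, forall e f, cls e = cls f -> k - 1 <= #|e :&: f|}.
Proof.
move=> e f eH fH ef; apply: omit_meet => //.
by have := cls_refl fH; rewrite -ef inE => /andP[].
Qed.

Lemma cls_eq : {in H &, forall e f, k - 2 <= #|e :&: f| -> cls e = cls f}.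
Proof.
move=> e f eH fH ef; apply/setP => h; rewrite !inE; case hH: (h \in H) => //=.
apply/idP/idP => h1; apply: omit_trans h1 => //; by rewrite // setIC.
Qed.

Lemma cls_neq : {in H &, forall e f, cls e != cls f -> #|e :&: f| <= k - 3}.
Proof.
move=> e f eH fH; apply: contraNleq => h; apply/eqP/cls_eq => //; lia.
Qed.

Definition codeg (A : {set T}) := #|[set e in H | A \subset e]|.

(* Every edge [e] containing [A] is determined, up to [k + 1] choices, by a
   [(k - 2)]-set [S] with [A \subset S \subset e] which contains the vertex of
   [e] outside of a fixed representative of its class. *)
Lemma codeg_le (A : {set T}) : #|A| <= k - 3 ->
  codeg A <= (k + 1) * #|T| ^ (k - 2 - #|A|).
Proof.
move=> Ak.
pose rep e := odflt e [pick f in cls e].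
have rep_cls e : e \in H -> rep e \in H /\ k - 1 <= #|e :&: rep e|.
  move=> eH; rewrite /rep; case: pickP => [f|/(_ e)]; last by rewrite cls_refl.
  by rewrite inE => /andP[fH ef]; split=> //; apply: omit_meet.
have rep_eq e f : e \in H -> f \in H -> cls e = cls f -> rep e = rep f.
  move=> eH fH ef; rewrite /rep ef; case: pickP => // /(_ f).
  by rewrite cls_refl.
pose good e (S : {set T}) :=
  [&& A \subset S, S \subset e, #|S| == k - 2 & e :\: rep e \subset S].
pose SS := [set S : {set T} | (A \subset S) && (#|S| == k - 2)].
have SSle : #|SS| <= #|T| ^ (k - 2 - #|A|).
  apply: leq_trans (leq_bin_exp _ _); rewrite -card_draws.
  rewrite -(card_in_imset (f := fun S => S :\: A)).
    apply: subset_leq_card; apply/subsetP => X /imsetP[S].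
    by rewrite !inE => /andP[AS /eqP Sk] ->; rewrite cardsD (setIidPr AS) Sk.
  move=> S S'; rewrite !inE => /andP[AS _] /andP[AS' _] E.
  by rewrite -(setID S A) -(setID S' A) E (setIidPr AS) (setIidPr AS').
have goodE e : e \in H -> A \subset e -> exists S, good e S.
  move=> eH Ae; have [rH re] := rep_cls e eH.
  have De : #|e :\: rep e| <= 1.
    by rewrite cardsD (H_unif eH); lia.
  (* Adding at most one vertex to [A] keeps the size within [k - 2] because [A] has at most [k - 3]
     vertices. *)
  have [||S [AS Se Sk]] := @exists_subset_card _ (A :|: (e :\: rep e)) e (k - 2).
  - by rewrite subUset Ae subsetDl.
  - have := leq_of_leqif (leq_card_setU A (e :\: rep e)); rewrite (H_unif eH).
    move: De Ak; move: #|A| #|e :\: rep e| #|_ :|: _| => x y w; lia.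
  exists S; rewrite /good Se Sk eqxx /=.
  by move: AS; rewrite subUset => /andP[-> ->].
have fiber S : #|[set e in H | good e S]| <= k + 1.
  have [->|/set0Pn[e1]] := eqVneq [set e in H | good e S] set0.
    by rewrite cards0.
  rewrite inE => /andP[e1H /and4P[_ Se1 /eqP Sk _]].
  set e0 := rep e1; have [e0H _] := rep_cls e1 e1H.
  (* All edges counted here contain [S], so they have the common representative [e0]. Each is [e0]
     or arises from it by exchanging a vertex [x] for the vertex of [S] outside [e0]. *)
  apply: (@leq_trans #|e0 |: [set (e0 :\ x) :|: (S :\: e0) | x in e0]|).
    apply: subset_leq_card; apply/subsetP => e.
    rewrite !inE => /andP[eH /and4P[_ Se _ DS]].
    have re : rep e = e0.
      apply: rep_eq => //; apply: cls_eq => //; rewrite -Sk.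
      by apply: subset_leq_card; rewrite subsetI Se Se1.
    have [->|ne] := eqVneq e e0; first by [].
    have [_] := rep_cls e eH; rewrite re => ee0.
    have c1 : #|e0 :\: e| = 1.
      have := cardsID e e0; rewrite [e0 :&: e]setIC (H_unif e0H).
      have : #|e :&: e0| < k.
        rewrite ltn_neqAle -{2}(H_unif eH) subset_leq_card ?subsetIl // andbT.
        apply: contra ne => /eqP E; have : e :&: e0 == e.
          by rewrite eqEcard subsetIl E (H_unif eH) /=.
        move=> /eqP /setIidPl ss; by rewrite eqEcard ss (H_unif eH) (H_unif e0H) /=.
      move: ee0; move: #|e :&: e0| #|e0 :\: e| => x y; lia.
    have /cards1P[x ex] : #|e0 :\: e| == 1 by rewrite c1.
    have xe0 : x \in e0.
      have : x \in e0 :\: e by rewrite ex inE.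
      by rewrite inE => /andP[].
    apply/orP; right; apply/imsetP; exists x => //.
    apply/setP => y; rewrite !inE; move/setP/(_ y): ex; rewrite !inE => <-.
    case ye: (y \in e) => /=.
      case ye0: (y \in e0) => //=; rewrite (subsetP DS) //.
      by rewrite re inE ye ye0.
    have yS : (y \in S) = false by apply: contraFF ye; apply: (subsetP Se).
    by rewrite yS andbF orbF; case: (y \in e0).
  rewrite cardsU1 addnC leq_add ?leq_b1 //.
  by rewrite (leq_trans (leq_imset_card _ _)) // H_unif.
apply: (@leq_trans (\sum_(S in SS) #|[set e in H | good e S]|)); last first.
  apply: (@leq_trans (\sum_(S in SS) (k + 1))); first exact: leq_sum.
  by rewrite sum_nat_const mulnC leq_mul2l SSle orbT.
rewrite /codeg -sum1_card.
apply: (@leq_trans (\sum_(e in [set e in H | A \subset e])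
    \sum_(S in SS) (good e S : nat))).
  apply: leq_sum => e; rewrite inE => /andP[eH Ae].
  have [S gS] := goodE e eH Ae; rewrite (bigD1 S) /= ?gS //.
  by rewrite inE; case/and4P: gS => -> _ ->.
rewrite exchange_big /=; apply: leq_sum => S _.
rewrite -sum1_card big_mkcond [leqRHS]big_mkcond; apply: leq_sum => e _.
rewrite !inE; case: (e \in H) => //=; case: (good e S) => //=; by case: ifP.
Qed.

End Omitting.

(** * Expected numbers of unions of edges *)

Lemma ler_sum_setU (R : realType) (I : finType) (A B : {set I}) (f : I -> R) :
  (forall i, 0 <= f i) ->
  \sum_(i in A :|: B) f i <= \sum_(i in A) f i + \sum_(i in B) f i.
Proof.
move=> f0; rewrite big_mkcond [X in _ <= X + _]big_mkcond.
rewrite [X in _ <= _ + X]big_mkcond -big_split; apply: ler_sum => i _ /=.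
by rewrite inE; have := f0 i; do 2!case: (_ \in _) => /=; lra.
Qed.

Lemma ler_sum_bigcup (R : realType) (I J : finType) (A : J -> {set I})
    (f : I -> R) : (forall i, 0 <= f i) ->
  \sum_(i in \bigcup_j A j) f i <= \sum_j \sum_(i in A j) f i.
Proof.
move=> f0; rewrite big_mkcond.
under [leRHS]eq_bigr => j _ do rewrite big_mkcond.
rewrite exchange_big; apply: ler_sum => i _ /=; case: ifP => [/bigcupP[j _ ij]|_].
  by rewrite (bigD1 j) //= ij lerDl sumr_ge0 // => j' _; case: ifP.
by apply: sumr_ge0 => j _; case: ifP.
Qed.

Lemma ler_sum_imset (R : realType) (I J : finType) (D : {set I}) (h : I -> J)
    (f : J -> R) : (forall j, 0 <= f j) ->
  \sum_(j in h @: D) f j <= \sum_(i in D) f (h i).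
Proof.
move=> f0; rewrite [leRHS](partition_big h (mem (h @: D))) /=; last first.
  by move=> i iD; apply: imset_f.
apply: ler_sum => j /imsetP[i iD ->].
rewrite (bigD1 i) /=; last by rewrite iD eqxx.
by rewrite lerDl sumr_ge0.
Qed.

Section Weights.
Variables (R : realType) (T : finType) (H : {set {set T}}) (k : nat) (p : R).
Hypothesis p_ge0 : 0 <= p.
Hypothesis H_unif : {in H, forall e : {set T}, #|e| = k}.

(** The expected number of members of [F] contained in a random sample of density [p]. *)
Definition weight (F : {set {set T}}) : R := \sum_(W in F) p ^+ #|W|.

(** Sum over all pairs of [W] and [e], which may count a union repeatedly, and split off the factor
    of [e :\: W]. *)
Lemma weight_glue (P : pred nat) (F : {set {set T}}) (B : R) :
  (forall W, W \in F -> \sum_(e in H | P #|e :&: W|) p ^+ #|e :\: W| <= B) ->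
  weight (glue H P F) <= B * weight F.
Proof.
move=> hB; apply: (@le_trans _ _
  (\sum_(W in F) \sum_(e in H | P #|e :&: W|) p ^+ #|W :|: e|)); last first.
  rewrite /weight mulr_sumr; apply: ler_sum => W WF.
  rewrite mulrC; apply: le_trans (ler_wpM2l _ (hB W WF)); last exact: exprn_ge0.
  rewrite mulr_sumr; apply: ler_sum => e _.
  by rewrite -exprD -(cardsID W (W :|: e)) setUK setDUl setDv set0U.
pose D := [set x : {set T} * {set T} |
  (x.1 \in F) && ((x.2 \in H) && P #|x.2 :&: x.1|)].
have -> : glue H P F = (fun x => x.1 :|: x.2) @: D.
  apply/setP => X; apply/imset2P/imsetP => [[W e WF]|[[W e]]].
    by rewrite !inE => eP ->; exists (W, e); rewrite // inE WF eP.
  by rewrite inE /= => /andP[WF eP] ->; exists W e; rewrite // inE.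
have le_D := @ler_sum_imset R _ _ D (fun x => x.1 :|: x.2) (fun X => p ^+ #|X|)
  (fun X => exprn_ge0 _ p_ge0).
apply: (le_trans le_D) => {le_D}.
by rewrite pair_big_dep /= le_eqVlt; apply/orP; left; apply/eqP/eq_bigl => x;
  rewrite inE.
Qed.

(** There are at most [#|W| ^ i] traces [e :&: W] of size [i]; each belongs to at most [cd] edges,
    with [k - i] vertices outside [W]. *)
Lemma sum_meet (W : {set T}) i (cd : R) : 0 <= cd ->
  (forall A : {set T}, #|A| = i -> (codeg H A)%:R <= cd) ->
  \sum_(e in H | #|e :&: W| == i) p ^+ #|e :\: W|
    <= #|W|%:R ^+ i * (cd * p ^+ (k - i)).
Proof.
move=> cd0 hcd; have pk0 : 0 <= p ^+ (k - i) by rewrite exprn_ge0.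
rewrite (partition_big (fun e => e :&: W)
  (mem [set A : {set T} | (A \subset W) && (#|A| == i)])) /=; last first.
  by move=> e /andP[_ ei]; rewrite inE subsetIr.
apply: (@le_trans _ _ (\sum_(A in [set A : {set T} | (A \subset W) && (#|A| == i)])
    cd * p ^+ (k - i))).
  apply: ler_sum => A; rewrite inE => /andP[AW /eqP Ai].
  apply: (@le_trans _ _ (\sum_(e in [set e in H | A \subset e]) p ^+ (k - i))).
    rewrite big_mkcond [leRHS]big_mkcond; apply: ler_sum => e _.
    rewrite inE; case: (boolP (e \in H)) => //= eH; case: eqP => //= ei.
      case: eqP => [eA|_]; last by case: ifP.
      by rewrite -eA subsetIl cardsD (H_unif eH) ei.
    by case: ifP.
  rewrite sumr_const -[_ *+ _]mulr_natl; apply: ler_wpM2r => //; exact: hcd.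
rewrite sumr_const -[_ *+ _]mulr_natl cards_draws -natrX.
by rewrite ler_wpM2r ?mulr_ge0 // ler_nat leq_bin_exp.
Qed.

Lemma grow_card j W : W \in grow H k j -> (#|W| <= k * j.+1)%N.
Proof.
elim: j W => [|j IH] W /=; first by move=> /H_unif ->; rewrite muln1.
case/imset2P=> V e /IH Vj; rewrite inE => /andP[/H_unif ek _] ->.
rewrite mulnS addnC; apply: leq_trans (leq_of_leqif (leq_card_setU _ _)) _.
by rewrite ek leq_add2r.
Qed.

End Weights.

(** * Sparsification *)

Lemma ler_sum_split (R : realType) (I : finType) (A : {set I}) (m : I -> nat)
    (k : nat) (P : pred nat) (f : I -> R) (b : R) :
  (forall i, 0 <= f i) -> 0 <= b -> (forall i, P i -> (i < k)%N) ->
  (forall i, P i -> \sum_(x in A | m x == i) f x <= b) ->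
  \sum_(x in A | P (m x)) f x <= k%:R * b.
Proof.
move=> f0 b0 Pk hb.
apply: (@le_trans _ _ (\sum_(i < k | P i) \sum_(x in A | m x == i) f x)).
  rewrite (exchange_big_dep (mem A)) /=; last by move=> i x _ /andP[].
  rewrite big_mkcondr; apply: ler_sum => x xA; case: ifP => [Px|_].
    by rewrite (bigD1 (Ordinal (Pk _ Px))) /= ?xA ?Px ?eqxx // lerDl sumr_ge0.
  exact: sumr_ge0.
rewrite big_mkcond /= mulr_natl -[X in _ *+ X](card_ord k) -sumr_const.
by apply: ler_sum => i _; case: ifP => // /hb.
Qed.

Local Ltac nlia :=
  repeat match goal with
  | h : is_true (leq _ _) |- _ => revert h
  | h : is_true (leq _ _ && leq _ _) |- _ => revert h
  | h : @eq nat _ _ |- _ => revert h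
  end; clear; lia.

Section Sparse.
Variables (R : realType) (T : finType) (H : {set {set T}}) (k M : nat).
Variables (p a d sg : R).
Hypothesis k_ge4 : (4 <= k)%N.
Hypothesis H_unif : {in H, forall e : {set T}, #|e| = k}.
Hypothesis H_omit :
  {in H &, forall e e' : {set T}, e != e' -> (#|e :&: e'| != k - 2)%N}.
Hypothesis p_gt0 : 0 < p.
Hypothesis p_le1 : p <= 1.
Hypothesis a_ge1 : 1 <= a.
(** In expectation the sample has [s = p n] vertices and at most [(k + 1) s a] edges, so typical
    degrees have order [a]. The choice of [d] makes the loss [k / d * (k + 1) s a] of the degree
    deletion equal to [s / 4]. *)
Hypothesis pE : p ^+ (k - 1) * #|T|%:R ^+ (k - 3) = a.
Hypothesis dE : d = 4 * k%:R * (k + 1)%:R * a.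
Hypothesis sg_ge1 : 1 <= sg.
Hypothesis sgE : sg ^+ 2 = p * #|T|%:R.
Hypothesis M_gt0 : (0 < M)%N.
Let w : R := (k * M)%:R.
Hypothesis sg_ge :
  32 * k%:R * M%:R * w ^+ k * d ^+ 3 * (2 * k%:R * w ^+ k * d) ^+ M <= sg.

Let n : R := #|T|%:R.
Let s : R := p * n.
Let t : R := 2 * d / p.
Let Hs : {set {set T}} := [set e in H |
  [forall S : {set T}, (S \subset e) && (#|S| == k - 1)%N ==>
     ((codeg H S)%:R <= t)]].

Let p_ge0 : 0 <= p. Proof. exact: ltW. Qed.
Let n_ge0 : 0 <= n. Proof. exact: ler0n. Qed.
Let k4 : 4 <= k%:R :> R. Proof. by rewrite (ler_nat R 4). Qed.
Let k1_ge1 : 1 <= (k + 1)%:R :> R. Proof. by rewrite ler1n addn1. Qed.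
Let ka_ge1 : 1 <= (k + 1)%:R * a. Proof. exact: mulr_ege1. Qed.
Let ka_le_d : (k + 1)%:R * a <= d.
Proof.
rewrite dE -mulrA ler_peMl ?(le_trans ler01 ka_ge1) //.
by have := k4; lra.
Qed.
Let d_ge1 : 1 <= d. Proof. exact: le_trans ka_ge1 ka_le_d. Qed.
Let a_le_d : a <= d.
Proof. by apply: le_trans ka_le_d; rewrite ler_peMl // (le_trans ler01 a_ge1). Qed.
Let s_ge1 : 1 <= s. Proof. by rewrite /s -sgE exprn_ege1. Qed.
Let w_ge1 : 1 <= w. Proof. by rewrite /w ler1n muln_gt0 M_gt0 andbT (leq_trans _ k_ge4). Qed.
Let t_ge0 : 0 <= t.
Proof. by rewrite divr_ge0 // mulr_ge0 // (le_trans _ d_ge1). Qed.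
Let tp : t * p = 2 * d. Proof. by rewrite /t divfK // gt_eqF. Qed.

Lemma edge_count_weight : n ^+ (k - 2) * p ^+ k = s * a.
Proof.
rewrite -pE -/n /s; have -> : (k - 2 = (k - 3).+1)%N by nlia.
by have {2}-> : (k = (k - 1).+1)%N; [nlia | rewrite !exprS; ring].
Qed.

(** Up to a constant, for [i <= k - 3], the first two factors bound the expected number of ways to
    complete an [i]-set to an edge: [a] for one vertex, divided by [s] for every further one. *)
Lemma codeg_weight i : (1 <= i <= k - 2)%N ->
  n ^+ (k - 2 - i) * p ^+ (k - i) * s ^+ (i - 1) = a.
Proof.
move=> ik; rewrite -pE -/n /s exprMn.
have -> : (k - 1 = (k - i) + (i - 1))%N by nlia.
have -> : (k - 3 = (k - 2 - i) + (i - 1))%N by nlia.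
by rewrite !exprD; ring.
Qed.

(** The case [i = k - 2] of [codeg_weight] reads [p ^ 2 s ^ (k - 3) = a]; since [k >= 4], it yields
    [p ^ 2 s <= a <= d ^ 2]. *)
Lemma p_le : p <= d / sg.
Proof.
have sg0 : 0 < sg by rewrite (lt_le_trans ltr01).
rewrite -(ler_pXn2r (n := 2%N)) ?nnegrE ?divr_ge0 ?(le_trans ler01 d_ge1) ?(ltW sg0) //.
rewrite expr_div_n ler_pdivlMr ?exprn_gt0 // sgE -/n -/s.
have /codeg_weight : (1 <= k - 2 <= k - 2)%N by nlia.
rewrite subnn expr0 mul1r (_ : (k - (k - 2) = 2)%N); last by nlia.
rewrite (_ : (k - 2 - 1 = (k - 4).+1)%N); last by nlia.
rewrite [s ^+ _]exprS => E; apply: (@le_trans _ _ a).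
  by rewrite -E [leRHS]mulrA ler_peMr ?mulr_ge0 ?exprn_ge0 ?exprn_ege1 //.
by rewrite (le_trans a_le_d) // expr2 ler_peMl // (le_trans ler01 d_ge1).
Qed.

Lemma Hs_sub : Hs \subset H.
Proof. by apply/subsetP => e; rewrite inE => /andP[]. Qed.

Let Hs_unif : {in Hs, forall e : {set T}, #|e| = k}.
Proof. by move=> e /(subsetP Hs_sub)/H_unif. Qed.

Lemma codeg_Hs_small (A : {set T}) : (#|A| <= k - 3)%N ->
  (codeg Hs A)%:R <= (k + 1)%:R * n ^+ (k - 2 - #|A|).
Proof.
move=> Ak; rewrite -natrX -natrM ler_nat.
apply: leq_trans (codeg_le k_ge4 H_unif H_omit Ak); apply: subset_leq_card.
by apply/subsetP => e; rewrite !inE => /andP[/andP[-> _] ->].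
Qed.

Lemma codeg_Hs_top (A : {set T}) : #|A| = (k - 1)%N -> (codeg Hs A)%:R <= t.
Proof.
move=> Ak; rewrite /codeg.
have [->|/set0Pn[e]] := eqVneq [set e in Hs | A \subset e] set0.
  by rewrite cards0.
rewrite !inE => /andP[/andP[eH /forallP/(_ A)]]; rewrite Ak eqxx andbT => /implyP h Ae.
apply: le_trans (h Ae); rewrite ler_nat; apply: subset_leq_card.
by apply/subsetP => f; rewrite !inE => /andP[/andP[-> _] ->].
Qed.

(** Fix an edge [e] containing [A], with two further vertices [x], [y]. Any edge containing [A]
    meets [e] in at least [k - 2], hence [k - 1] vertices, so it contains [x] or [y]. *)
Lemma codeg_Hs_middle (A : {set T}) : #|A| = (k - 2)%N -> (codeg Hs A)%:R <= 2 * t.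
Proof.
move=> Ak; rewrite /codeg.
have [->|/set0Pn[e]] := eqVneq [set e in Hs | A \subset e] set0.
  by rewrite cards0 mulr_ge0.
rewrite inE => /andP[eHs Ae]; have eH := subsetP Hs_sub _ eHs.
have /cards2P[x [y [xy eA]]] : #|e :\: A| == 2.
  by rewrite cardsD (setIidPr Ae) (H_unif eH) Ak; apply/eqP; nlia.
have xyA z : z \in [set x; y] -> z \notin A.
  by rewrite -eA inE => /andP[].
have cz z : z \in [set x; y] -> (codeg Hs (z |: A))%:R <= t.
  by move=> /xyA zA; apply: codeg_Hs_top; rewrite cardsU1 zA Ak; nlia.
have {}cx := cz x (set21 _ _); have {cz}cy := cz y (set22 _ _).
apply: (@le_trans _ _ ((codeg Hs (x |: A))%:R + (codeg Hs (y |: A))%:R)); last first.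
  by rewrite mulr_natl mulr2n lerD.
rewrite -natrD ler_nat /codeg.
apply: leq_trans (leq_of_leqif (leq_card_setU _ _)); apply: subset_leq_card.
apply/subsetP => f; rewrite in_set => /andP[fHs Af].
have fH := subsetP Hs_sub _ fHs.
have ef : (k - 1 <= #|e :&: f|)%N.
  apply: (omit_meet k_ge4 H_unif H_omit) => //; rewrite -Ak.
  by apply: subset_leq_card; rewrite subsetI Ae Af.
suff /orP zf : (x \in f) || (y \in f).
  rewrite in_setU; apply/orP; case: zf => zf; [left|right];
  by rewrite in_set; apply/andP; split=> //; rewrite subUset sub1set zf.
apply/norP => -[xf yf].
have : (#|[set x; y]| <= #|e :\: f|)%N.
  apply: subset_leq_card; rewrite -eA; apply/subsetP => z zeA.
  have := zeA; rewrite eA in_set2 => zxy; rewrite inE.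
  have -> : z \in e by move: zeA; rewrite inE => /andP[].
  by rewrite andbT; case/orP: zxy => /eqP ->.
rewrite cards2 xy /=; have := cardsID f e; rewrite (H_unif eH).
by move: ef; move: #|e :&: f| #|e :\: f| => u v; nlia.
Qed.

Section Union.
Variable W : {set T}.
Hypothesis Ww : #|W|%:R <= w.

Let Wi i : (i <= k)%N -> #|W|%:R ^+ i <= w ^+ k.
Proof.
move=> ik; apply: (@le_trans _ _ (w ^+ i)).
  by rewrite lerXn2r ?nnegrE ?ler0n // (le_trans ler01 w_ge1).
exact: ler_weXn2l.
Qed.

Let wk0 : 0 <= w ^+ k. Proof. by rewrite exprn_ge0 // (le_trans ler01 w_ge1). Qed.

(** Traces of size [1] contribute [(k + 1) a <= d] each by [pE], traces of size [k - 1] contribute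
    [t p = 2 d]. *)
Lemma growth_sum :
  \sum_(e in Hs | [pred i | (i == 1) || (i == k.-1)] #|e :&: W|) p ^+ #|e :\: W|
    <= 2 * k%:R * w ^+ k * d.
Proof.
have -> : 2 * k%:R * w ^+ k * d = k%:R * (w ^+ k * (2 * d)) by ring.
have d0 := le_trans ler01 d_ge1.
apply: (@ler_sum_split R _ Hs (fun e => #|e :&: W|) k
  [pred i | (i == 1) || (i == k.-1)] (fun e => p ^+ #|e :\: W|)).
- by move=> e; rewrite exprn_ge0.
- by rewrite mulr_ge0 ?mulr_ge0.
- by move=> i /orP[]/eqP ->; nlia.
move=> i /orP[]/eqP ->.
- apply: le_trans (@sum_meet _ _ Hs k p p_ge0 Hs_unif W 1
    ((k + 1)%:R * n ^+ (k - 3)) _ _) _.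
  + by rewrite mulr_ge0 ?exprn_ge0.
  + by move=> A A1; have := @codeg_Hs_small A; rewrite A1 -subnDA; apply; nlia.
  rewrite -mulrA [n ^+ _ * _]mulrC pE; apply: ler_pM.
  + by rewrite exprn_ge0.
  + by rewrite mulr_ge0 // (le_trans ler01 a_ge1).
  + by apply: Wi; nlia.
  by apply: (le_trans ka_le_d); lra.
- apply: le_trans (@sum_meet _ _ Hs k p p_ge0 Hs_unif W k.-1 t t_ge0 _) _.
  + by move=> A; rewrite -subn1; apply: codeg_Hs_top.
  rewrite (_ : (k - k.-1 = 1)%N); last by nlia.
  by rewrite expr1 tp ler_wpM2r ?mulr_ge0 // Wi //; nlia.
Qed.

(** For [2 <= i <= k - 3] a factor [1/s <= 1/sg] is gained by [codeg_weight]; for [i = k - 2] the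
    contribution [2 t p ^ 2 = 4 d p] is small by [p_le]. *)
Lemma closing_sum :
  \sum_(e in Hs | [pred i | (2 <= i <= k - 2)%N] #|e :&: W|) p ^+ #|e :\: W|
    <= 4 * k%:R * w ^+ k * d ^+ 2 / sg.
Proof.
have -> : 4 * k%:R * w ^+ k * d ^+ 2 / sg = k%:R * (w ^+ k * (4 * d ^+ 2 / sg)).
  by ring.
have d0 := le_trans ler01 d_ge1; have sg0 : 0 < sg := lt_le_trans ltr01 sg_ge1.
have b0 : 0 <= 4 * d ^+ 2 / sg by rewrite divr_ge0 ?mulr_ge0 ?exprn_ge0 // ltW.
apply: (@ler_sum_split R _ Hs (fun e => #|e :&: W|) k
  [pred i | (2 <= i <= k - 2)%N] (fun e => p ^+ #|e :\: W|)).
- by move=> e; rewrite exprn_ge0.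
- by rewrite mulr_ge0.
- by move=> i /=; nlia.
move=> i /= ik; have [ik3|ik2] : (i <= k - 3)%N \/ i = (k - 2)%N by nlia.
- apply: le_trans (@sum_meet _ _ Hs k p p_ge0 Hs_unif W i
    ((k + 1)%:R * n ^+ (k - 2 - i)) _ _) _.
  + by rewrite mulr_ge0 ?exprn_ge0.
  + by move=> A Ai; rewrite -Ai; apply: codeg_Hs_small; rewrite Ai.
  have np0 : 0 <= n ^+ (k - 2 - i) * p ^+ (k - i) by rewrite mulr_ge0 ?exprn_ge0.
  rewrite -mulrA; apply: ler_pM.
  + by rewrite exprn_ge0.
  + by rewrite mulr_ge0.
  + by apply: Wi; nlia.
  rewrite ler_pdivlMr //; apply: (@le_trans _ _ d).
    apply: le_trans ka_le_d; rewrite -mulrA ler_wpM2l //.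
    rewrite -(@codeg_weight i); last by nlia.
    rewrite ler_wpM2l // (_ : (i - 1 = (i - 2).+1)%N); last by nlia.
    have sgs : sg <= s by rewrite /s -sgE expr2 ler_peMl // ltW.
    rewrite exprS; apply: le_trans sgs _; rewrite ler_peMr ?exprn_ege1 //.
    exact: le_trans ler01 s_ge1.
  by have := d_ge1; nra.
- apply: le_trans (@sum_meet _ _ Hs k p p_ge0 Hs_unif W i (2 * t) _ _) _.
  + by rewrite mulr_ge0.
  + by rewrite ik2; apply: codeg_Hs_middle.
  rewrite (_ : (k - i = 2)%N); last by nlia.
  have -> : 2 * t * p ^+ 2 = 4 * d * p by rewrite expr2 mulrA -[2 * t * p]mulrA tp; ring.
  apply: ler_pM.
  + by rewrite exprn_ge0.
  + by rewrite !mulr_ge0.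
  + by apply: Wi; nlia.
  have -> : 4 * d ^+ 2 / sg = 4 * d * (d / sg) by ring.
  by rewrite ler_wpM2l ?p_le // mulr_ge0.
Qed.

End Union.

Lemma card_H_weight : #|H|%:R * p ^+ k <= (k + 1)%:R * (s * a).
Proof.
rewrite -edge_count_weight mulrA ler_wpM2r ?exprn_ge0 //.
have := @codeg_le _ H k k_ge4 H_unif H_omit set0; rewrite cards0 subn0 => /(_ isT).
have -> : codeg H set0 = #|H|.
  by rewrite /codeg; apply: eq_card => e; rewrite inE sub0set andbT.
by rewrite -natrX -natrM ler_nat.
Qed.

Let w_card j W : (j < M)%N -> W \in grow Hs k j -> #|W|%:R <= w.
Proof.
move=> jM /(grow_card Hs_unif) Wj; rewrite ler_nat (leq_trans Wj) //.
by rewrite leq_mul2l jM orbT.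
Qed.

Lemma weight_grow j : (j <= M)%N ->
  weight p (grow Hs k j) <= (2 * k%:R * w ^+ k * d) ^+ j * (s * d).
Proof.
elim: j => [|j IH] jM.
  rewrite expr0 mul1r /weight /=.
  apply: (@le_trans _ _ (#|H|%:R * p ^+ k)).
    rewrite mulr_natl -sumr_const big_mkcond [leRHS]big_mkcond.
    apply: ler_sum => e _; have pk0 : 0 <= p ^+ k by rewrite exprn_ge0.
    case: ifP => [eHs|_]; last by case: ifP.
    by rewrite (subsetP Hs_sub _ eHs) (Hs_unif eHs).
  apply: le_trans card_H_weight _; rewrite mulrCA ler_wpM2l //.
  exact: le_trans ler01 s_ge1.
rewrite /grow iterS exprS -mulrA.
have B0 : 0 <= 2 * k%:R * w ^+ k * d.
  by rewrite !mulr_ge0 ?exprn_ge0 ?(le_trans ler01 w_ge1) ?(le_trans ler01 d_ge1).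
apply: le_trans (ler_wpM2l B0 (IH (ltnW jM))).
by apply: weight_glue => // W /(w_card jM) Ww; apply: growth_sum.
Qed.

(** The factor [1/sg] of the closing edge outweighs, by [sg_ge], the factors of up to [M] growth
    steps. *)
Lemma weight_close j : (j < M)%N -> weight p (close Hs k j) <= s / (8 * M%:R).
Proof.
move=> jM; have d0 := le_trans ler01 d_ge1; have sg0 := lt_le_trans ltr01 sg_ge1.
have w0 := le_trans ler01 w_ge1; have s0 := le_trans ler01 s_ge1.
have M0 : 0 < M%:R :> R by rewrite ltr0n.
set B := 2 * k%:R * w ^+ k * d; set eps := 4 * k%:R * w ^+ k * d ^+ 2 / sg.
have eps0 : 0 <= eps by rewrite divr_ge0 ?mulr_ge0 ?exprn_ge0 // ltW.
apply: (@le_trans _ _ (eps * (B ^+ M * (s * d)))).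
  apply: (@le_trans _ _ (eps * weight p (grow Hs k j))).
    by apply: weight_glue => // W /(w_card jM) Ww; apply: closing_sum.
  rewrite ler_wpM2l //; apply: le_trans (weight_grow (ltnW jM)) _.
  apply: ler_wpM2r; first exact: mulr_ge0.
  apply: ler_weXn2l (ltnW jM); rewrite /B.
  apply: mulr_ege1 d_ge1; apply: mulr_ege1; last exact: exprn_ege1.
  by have := k4; lra.
rewrite ler_pdivlMr ?mulr_gt0 // /eps.
have -> : 4 * k%:R * w ^+ k * d ^+ 2 / sg * (B ^+ M * (s * d)) * (8 * M%:R) =
  (32 * k%:R * M%:R * w ^+ k * d ^+ 3 * B ^+ M) / sg * s by ring.
by rewrite ler_piMl // ler_pdivrMr // mul1r.
Qed.

Let large := [set S : {set T} | (#|S| == k - 1)%N && (t < (codeg H S)%:R)].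

(** Double counting bounds [#|large| t] by [k #|H|], and passing from [p ^ k] to [p ^ (k - 1)] costs
    [1/p], which [t p = 2 d] absorbs. *)
Lemma weight_large : weight p large <= s / 8.
Proof.
have d0 : 0 < d := lt_le_trans ltr01 d_ge1.
have t_gt0 : 0 < t by rewrite divr_gt0 // mulr_gt0.
have -> : weight p large = #|large|%:R * p ^+ (k - 1).
  rewrite mulr_natl -sumr_const; apply: eq_bigr => S.
  by rewrite inE => /andP[/eqP ->].
have cl : #|large|%:R * t <= k%:R * #|H|%:R.
  rewrite mulr_natl -sumr_const.
  apply: (@le_trans _ _ (\sum_(S in large) (codeg H S)%:R)).
    by apply: ler_sum => S; rewrite inE => /andP[_ /ltW].
  rewrite -natr_sum -natrM ler_nat.
  apply: (@leq_trans (\sum_(S : {set T} | #|S| == k - 1) codeg H S)%N).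
    rewrite big_mkcond [leqRHS]big_mkcond; apply: leq_sum => S _.
    by rewrite inE; case: eqP => //= _; case: ifP.
  have -> : (\sum_(S : {set T} | #|S| == k - 1) codeg H S =
    \sum_(e in H) #|[set S : {set T} | (S \subset e) && (#|S| == k - 1)]|)%N.
    rewrite (eq_bigr (fun S : {set T} => \sum_(e in H) (S \subset e : nat))%N).
      rewrite exchange_big; apply: eq_bigr => e _ /=.
      rewrite -sum1_card big_mkcond [RHS]big_mkcond; apply: eq_bigr => S _ /=.
      by rewrite inE; case: (S \subset e); case: eqP.
    move=> S _; rewrite /codeg -sum1_card big_mkcond [RHS]big_mkcond.
    by apply: eq_bigr => e _; rewrite inE; case: (e \in H) => //=; case: ifP.
  rewrite mulnC -sum_nat_const; apply: leq_sum => e eH.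
  rewrite cards_draws (H_unif eH) bin_sub; last by nlia.
  by rewrite bin1.
have pk0 : 0 < p ^+ k by rewrite exprn_gt0.
have : #|large|%:R * t * p ^+ k <= k%:R * ((k + 1)%:R * (s * a)).
  apply: le_trans (ler_wpM2r (ltW pk0) cl) _.
  by rewrite -mulrA ler_wpM2l // card_H_weight.
have -> : p ^+ k = p * p ^+ (k - 1) by rewrite -exprS; congr (_ ^+ _); nlia.
have -> : #|large|%:R * t * (p * p ^+ (k - 1)) = #|large|%:R * p ^+ (k - 1) * (2 * d).
  by rewrite -tp; ring.
have -> : k%:R * ((k + 1)%:R * (s * a)) = s / 8 * (2 * d) by rewrite dE; field.
by rewrite ler_pM2r // mulr_gt0.
Qed.

Lemma sparse_subset : exists A : {set T},
  [/\ p * #|T|%:R / 2 <= #|A|%:R,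
      {in A, forall v,
         #|[set e in [set e in H | e \subset A] | v \in e]|%:R <= d} &
      acyclic_upto [set e in H | e \subset A] (cls H k) M].
Proof.
have d0 : 0 < d := lt_le_trans ltr01 d_ge1.
have M0 : 0 < M%:R :> R by rewrite ltr0n.
pose F := large :|: \bigcup_(j < M) close Hs k j.
have F0 : set0 \notin F.
  rewrite !inE cards0 negb_or; apply/andP; split.
    by rewrite negb_and; apply/orP; left; apply/eqP; nlia.
  apply/bigcupP => -[j _ /imset2P[W e _]]; rewrite inE => /andP[/Hs_unif ek _].
  by move/esym/eqP; rewrite setU_eq0 -[e == _]cards_eq0 ek => /andP[_ /eqP]; nlia.
have [A [AF Ad Acard]] := sample_deletion p_ge0 p_le1 d0 H_unif F0.
exists A; split=> //.
- apply: le_trans Acard; rewrite -/n -/s.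
  (* The losses are [s / 8] for [large], [s / 8] for the [M] closing families and [s / 4] for the
     degrees, so half of the sample remains. *)
  have h1 : \sum_(W in F) p ^+ #|W| <= s / 8 + s / 8.
    apply: le_trans (ler_sum_setU _ _ _) _; first by move=> W; rewrite exprn_ge0.
    apply: lerD; first exact: weight_large.
    apply: le_trans (ler_sum_bigcup _ _) _; first by move=> W; rewrite exprn_ge0.
    apply: (@le_trans _ _ (\sum_(j < M) s / (8 * M%:R))).
      by apply: ler_sum => j _; apply: weight_close.
    rewrite sumr_const card_ord -[_ *+ M]mulr_natr.
    by rewrite le_eqVlt; apply/orP; left; apply/eqP; field; rewrite gt_eqF.
  have h2 : k%:R / d * (#|H|%:R * p ^+ k) <= s / 4.
    apply: (@le_trans _ _ (k%:R / d * ((k + 1)%:R * (s * a)))).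
      by rewrite ler_wpM2l ?divr_ge0 ?card_H_weight // ltW.
    rewrite le_eqVlt; apply/orP; left; apply/eqP.
    have a0 : a != 0 by rewrite gt_eqF // (lt_le_trans ltr01).
    have k0 : k%:R != 0 :> R by rewrite pnatr_eq0; nlia.
    have k10 : (k + 1)%:R != 0 :> R by rewrite pnatr_eq0; nlia.
    rewrite dE; move: (k + 1)%:R k10 => K1 k10.
    by field; rewrite a0 k10 k0.
  by move: h1 h2; lra.
have -> : [set e in H | e \subset A] = [set e in Hs | e \subset A].
  apply/setP => e; rewrite !inE; case: (boolP (e \subset A)) => eA; rewrite ?andbF //.
  case: (e \in H) => //=; apply/esym; rewrite andbT.
  apply/forallP => S; apply/implyP => /andP[Se Sk]; rewrite leNgt; apply/negP => tS.
  have /AF/negP : S \in F by rewrite !inE Sk tS.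
  by apply; apply: subset_trans Se eA.
apply: (@clean_acyclic _ _ _ _ k) => //.
- move=> e f /(subsetP Hs_sub) eH /(subsetP Hs_sub) fH.
  exact: (cls_neq k_ge4 H_unif H_omit).
- move=> e f /(subsetP Hs_sub) eH /(subsetP Hs_sub) fH ef.
  by rewrite -card_gt0; have := cls_meet k_ge4 H_unif H_omit eH fH ef; nlia.
- move=> j X jM Xj; apply: AF; rewrite inE; apply/orP; right.
  by apply/bigcupP; exists (Ordinal jM).
Qed.

End Sparse.

(** * Choice of the parameters *)

Lemma powR_root (R : realType) (x : R) (r : nat) : 0 <= x -> (0 < r)%N ->
  (x `^ (1 / r%:R)) ^+ r = x.
Proof.
move=> x0 r0; rewrite -powR_mulrn ?powR_ge0 // -powRrM divfK ?powRr1 //.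
by rewrite pnatr_eq0 -lt0n.
Qed.

Lemma expR1_le4 (R : realType) : expR 1 <= 4 :> R.
Proof.
have h : 2^-1 <= expR (- 2^-1) :> R by have := expR_ge1Dx (- 2^-1 : R); lra.
have e0 := expR_gt0 (2^-1 : R).
have h2 : expR (2^-1) <= 2 :> R.
  by move: h; rewrite expRN lef_pV2 ?posrE.
have -> : (1 : R) = 2^-1 + 2^-1 by lra.
by rewrite expRD; nra.
Qed.

Section TargetDegree.
Variables (R : realType) (k Q : nat).
Hypothesis k_ge4 : (4 <= k)%N.
Hypothesis Q_ge : (160 * k <= Q)%N.
Let q : R := Q%:R.

(** The solution of [2 d (5 / q) ^ (k - 1) = ln (q / 4)], for which the exponential in [pr_final]
    equals [4 / q]. *)
Definition target_degree : R := ln (q / 4) / 2 * (q / 5) ^+ (k - 1).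
Let d := target_degree.

Let q_ge640 : 640 <= q.
Proof. by rewrite /q (ler_nat R 640); lia. Qed.

Lemma ln_q_ge1 : 1 <= ln (q / 4).
Proof.
rewrite -[leLHS]expRK ler_ln ?posrE ?expR_gt0 //; last by have := q_ge640; lra.
by apply: le_trans (expR1_le4 R) _; have := q_ge640; lra.
Qed.

Lemma target_degree_le : d <= q ^+ k.
Proof.
have q6 := q_ge640; have l1 := ln_q_ge1.
have {1}-> : (k = (k - 1).+1)%N by lia.
rewrite exprS /d /target_degree; apply: ler_pM.
- lra.
- by rewrite exprn_ge0 //; lra.
- have : ln (q / 4) < q / 4 by apply: ln_sublinear; lra.
  lra.
- by rewrite lerXn2r ?nnegrE; lra.
Qed.

(** From [q / 5 >= 32 k], already the square of [q / 5] suffices; this will give [a >= 1]. *)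
Lemma target_degree_ge : 4 * k%:R * (k + 1)%:R <= d.
Proof.
have q6 := q_ge640; have l1 := ln_q_ge1.
have k4 : 4 <= k%:R :> R by rewrite (ler_nat R 4).
have qk : 160 * k%:R <= q by rewrite /q -natrM ler_nat.
have q5 : 1 <= q / 5 by lra.
have h : (q / 5) ^+ 2 <= (q / 5) ^+ (k - 1) by apply: ler_weXn2l => //; lia.
rewrite natrD /d /target_degree.
apply: (@le_trans _ _ (2^-1 * (q / 5) ^+ 2)).
  have : (32 * k%:R) ^+ 2 <= (q / 5) ^+ 2.
    by rewrite lerXn2r ?nnegrE; lra.
  by rewrite !expr2; nra.
by apply: ler_pM => //; rewrite ?exprn_ge0 //; lra.
Qed.

Lemma target_degree_greedy :
  2 < q * expR (- (2 * d * (5 / q) ^+ (k - 1))).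
Proof.
have q6 := q_ge640; have q0 : q != 0 by rewrite gt_eqF //; lra.
have -> : 2 * d * (5 / q) ^+ (k - 1) = ln (q / 4).
  rewrite /d /target_degree -mulrA -mulrA -exprMn.
  have -> : q / 5 * (5 / q) = 1 by field.
  by rewrite expr1n mulr1; field.
rewrite expRN lnK; last by rewrite posrE; lra.
have -> : q * (q / 4)^-1 = 4 by field.
by lra.
Qed.

(** Every factor is at most a power of [q], the exponents add up to at most [8 k Q], and
    [q <= expR q]. *)
Lemma growth_bound (w : R) : w = (k * Q.*2)%:R ->
  32 * k%:R * Q.*2%:R * w ^+ k * d ^+ 3 * (2 * k%:R * w ^+ k * d) ^+ Q.*2
    <= expR (8 * k%:R * q ^+ 2).
Proof.
move=> wE; have q6 := q_ge640; have q1 : 1 <= q by lra.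
have d0 : 0 <= d by apply: le_trans target_degree_ge; rewrite !mulr_ge0.
have dq := target_degree_le.
have w0 : 0 <= w by rewrite wE ler0n.
have wq : w <= q ^+ 2.
  by rewrite wE /q -natrX ler_nat; move: k_ge4 Q_ge; clear; nia.
have wk0 : 0 <= w ^+ k by rewrite exprn_ge0.
have wk : w ^+ k <= q ^+ (2 * k) by rewrite exprM lerXn2r ?nnegrE // exprn_ge0 //; lra.
have kM : 32 * k%:R * Q.*2%:R <= q ^+ 2.
  by rewrite /q -!natrM -natrX ler_nat; move: k_ge4 Q_ge; clear; nia.
have k2 : 2 * k%:R <= q.
  by rewrite /q -natrM ler_nat; move: k_ge4 Q_ge; clear; lia.
have B : 2 * k%:R * w ^+ k * d <= q ^+ (3 * k + 1).
  have -> : (3 * k + 1 = 1 + 2 * k + k)%N by clear; lia.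
  rewrite exprD exprD expr1; apply: ler_pM => //; first by rewrite !mulr_ge0.
  by apply: ler_pM => //; rewrite mulr_ge0.
apply: (@le_trans _ _ (q ^+ (8 * k * Q))).
  apply: (@le_trans _ _
    (q ^+ 2 * q ^+ (2 * k) * q ^+ (k * 3) * q ^+ ((3 * k + 1) * Q.*2))).
    have B0 : 0 <= 2 * k%:R * w ^+ k * d.
      by apply: mulr_ge0 => //; rewrite !mulr_ge0.
    apply: ler_pM.
    - by apply: mulr_ge0; rewrite ?exprn_ge0 // !mulr_ge0.
    - by rewrite exprn_ge0.
    - apply: ler_pM; [by rewrite !mulr_ge0 | by rewrite exprn_ge0 | |].
        by apply: ler_pM => //; rewrite !mulr_ge0.
      by rewrite exprM lerXn2r ?nnegrE // (le_trans d0).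
    - by rewrite exprM lerXn2r ?nnegrE // (le_trans B0).
  rewrite -!exprD; apply: ler_weXn2l => //; move: k_ge4 Q_ge; clear; nia.
apply: (@le_trans _ _ (expR q ^+ (8 * k * Q))).
  rewrite lerXn2r ?nnegrE ?expR_ge0 ?(le_trans ler01 q1) //.
  by apply: le_trans (expR_ge1Dx q); lra.
by rewrite -expRM_natl !natrM -/q expr2 mulrA.
Qed.

End TargetDegree.

(** Sparsification with [M = 2 Q] and the greedy process give [2 #|S| >= p n / Q]. In [(p n / Q) ^
    (k - 1) = n ^ 2 a / Q ^ (k - 1)] the power of [Q] contained in [a] cancels and the logarithm
    remains. *)
Lemma omitting_power_bound (R : realType) (k Q : nat) (T : finType)
    (H : {set {set T}}) : (4 <= k)%N -> (160 * k <= Q)%N ->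
  {in H, forall e : {set T}, #|e| = k} ->
  {in H &, forall e e' : {set T}, e != e' -> (#|e :&: e'| != k - 2)%N} ->
  8 * k%:R ^+ 2 * Q%:R ^+ 2 <= ln (#|T|%:R : R) ->
  exists2 S : {set T}, independent H S &
    #|T|%:R ^+ 2 * ln (Q%:R / 4) / (8 * k%:R * (k + 1)%:R * 5 ^+ (k - 1))
      <= (2 * #|S|%:R : R) ^+ (k - 1).
Proof.
move=> k4 Qk Hk Ho; set n : R := #|T|%:R; set q : R := Q%:R => hn.
have q160 : 160 <= q by rewrite /q (ler_nat R 160); move: k4 Qk; clear; lia.
have qge0 : 0 <= q by rewrite /q ler0n.
have kR : 4 <= k%:R :> R by rewrite (ler_nat R 4).
have r0 : (0 < k - 1)%N by move: k4; clear; lia.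
have Q20 : (20 <= Q)%N by move: k4 Qk; clear; lia.
have r2 : (2 <= k - 1)%N by move: k4; clear; lia.
have kr : (k - 1).+1 = k by move: k4; clear; lia.
have lnn : 0 < ln n by apply: lt_le_trans hn; rewrite !mulr_gt0 ?exprn_gt0 //; lra.
have n0 : 0 < n.
  by rewrite lt_neqAle ler0n andbT; apply: contraTneq lnn => <-; rewrite ln0 ?ltxx.
have nE : n = expR (ln n) by rewrite lnK.
have n1 : 1 <= n by rewrite nE -expR0 ler_expR ltW.
have k0 : k%:R != 0 :> R by rewrite gt_eqF //; lra.
have k10 : (k + 1)%:R != 0 :> R by rewrite pnatr_eq0 addn1.
have K0 : 0 < 4 * k%:R * (k + 1)%:R :> R.
  by rewrite !mulr_gt0 // ltr0n ?addn1 // (leq_trans _ k4).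
pose d := target_degree R k Q; pose a := d / (4 * k%:R * (k + 1)%:R).
have dE : d = 4 * k%:R * (k + 1)%:R * a by rewrite /a mulrC divfK // gt_eqF.
have a1 : 1 <= a by rewrite /a ler_pdivlMr // mul1r; exact: target_degree_ge.
have a0 : 0 < a := lt_le_trans ltr01 a1.
have an : a <= n.
  apply: (@le_trans _ _ d).
    by rewrite dE ler_peMl ?(ltW a0) // natrD; nra.
  apply: le_trans (target_degree_le R k4 Qk) _; rewrite -/q.
  apply: (@le_trans _ _ (expR q ^+ k)).
    rewrite lerXn2r ?nnegrE ?expR_ge0 //.
    by apply: le_trans (expR_ge1Dx q); lra.
  rewrite -expRM_natl nE ler_expR; apply: le_trans hn; rewrite !expr2.
  have kq : 1 <= k%:R * q by nra.
  have kq0 : 0 <= k%:R * q by lra.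
  have -> : 8 * (k%:R * k%:R) * (q * q) = 8 * ((k%:R * q) * (k%:R * q)) by ring.
  by nra.
have n3 : 0 < n ^+ (k - 3) by rewrite exprn_gt0.
(* The density solving [p ^ (k - 1) n ^ (k - 3) = a]; it is at most [1] because [a <= n]. *)
pose p := (a / n ^+ (k - 3)) `^ (1 / (k - 1)%:R).
have p0 : 0 < p by rewrite powR_gt0 // divr_gt0.
have pr : p ^+ (k - 1) = a / n ^+ (k - 3).
  by rewrite powR_root // divr_ge0 // ltW.
have pE : p ^+ (k - 1) * n ^+ (k - 3) = a by rewrite pr divfK // gt_eqF.
have p1 : p <= 1.
  rewrite -(@expr_le1 _ (k - 1)) // ?(ltW p0) // pr ler_pdivrMr // mul1r.
  apply: (le_trans an); rewrite -{1}[n]expr1; apply: ler_weXn2l => //.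
  by move: k4; clear; lia.
have sr : (p * n) ^+ (k - 1) = n ^+ 2 * a.
  rewrite exprMn; have {2}-> : (k - 1 = (k - 3) + 2)%N by move: k4; clear; lia.
  by rewrite exprD mulrA pE mulrC.
have s0 : 0 < p * n by rewrite mulr_gt0.
pose sg := Num.sqrt (p * n).
have sg0 : 0 <= sg by rewrite sqrtr_ge0.
have sgE : sg ^+ 2 = p * n by rewrite sqr_sqrtr // ltW.
have sgr : n <= sg ^+ (k - 1).
  rewrite -(@ler_pXn2r _ 2%N) ?nnegrE ?exprn_ge0 ?(ltW n0) //.
  by rewrite -exprM mulnC exprM sgE sr ler_peMr // exprn_ge0 // ltW.
(* As [sg] is at least the [(k - 1)]-th root of [n], the lower bound on [ln n] suffices. *)
have sg_ge : expR (8 * k%:R * q ^+ 2) <= sg.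
  rewrite -(@ler_pXn2r _ (k - 1)) ?nnegrE ?expR_ge0 //; apply: le_trans sgr.
  rewrite -expRM_natl nE ler_expR; apply: le_trans hn.
  have -> : 8 * k%:R ^+ 2 * q ^+ 2 = k%:R * (8 * k%:R * q ^+ 2) by ring.
  rewrite ler_wpM2r ?mulr_ge0 ?exprn_ge0 //.
  by rewrite ler_nat leq_subr.
have sg1 : 1 <= sg.
  by apply: le_trans sg_ge; rewrite -[leLHS]expR0 ler_expR mulr_ge0 ?exprn_ge0 // mulr_ge0.
have M0 : (0 < Q.*2)%N by move: Q20; clear; lia.
have [A [Acard Adeg Aac]] := @sparse_subset R T H k Q.*2 p a d sg k4 Hk Ho p0 p1
  a1 pE dE sg1 sgE M0 (le_trans (growth_bound k4 Qk erefl) sg_ge).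
set HA := [set e in H | e \subset A] in Adeg Aac.
have HA_H : {subset HA <= H} by move=> e; rewrite inE => /andP[].
have [||||I [IA Iind Icard]] := @greedy_independent R T _ HA (cls H k) (k - 1) Q Q20
  r2 _ _ Aac d A.
- by move=> e /HA_H /Hk; rewrite kr.
- by move=> e f /HA_H eH /HA_H fH; apply: (cls_meet k4 Hk Ho).
- by move=> u /Adeg.
- exact: target_degree_greedy.
exists I.
  apply/negP => /exists_inP[e eH eI]; have /Iind : e \in HA.
    by rewrite inE eH (subset_trans eI).
  by rewrite eI.
have q0 : 0 < q by lra.
have le_s : p * n / q <= 2 * #|I|%:R.
  rewrite ler_pdivrMr //; have : #|A|%:R <= q * #|I|%:R by rewrite /q -natrM ler_nat.
  by move: Acard; rewrite -/n; lra.
apply: (@le_trans _ _ ((p * n / q) ^+ (k - 1))); last first.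
  by rewrite lerXn2r ?nnegrE ?mulr_ge0 ?invr_ge0 ?(ltW p0) ?(ltW n0).
rewrite expr_div_n sr /a /d /target_degree -/q expr_div_n.
have q0' : q ^+ (k - 1) != 0 by rewrite expf_neq0 // gt_eqF.
have f0 : 5 ^+ (k - 1) != 0 :> R by rewrite expf_neq0 // pnatr_eq0.
rewrite le_eqVlt; apply/orP; left; apply/eqP.
move: (q ^+ (k - 1)) q0' (5 ^+ (k - 1)) f0 ((k + 1)%:R) k10 => X X0 Y Y0 Z Z0.
by field; rewrite X0 Y0 Z0 k0.
Qed.

(** Take for [Q] the integer part of [y], where [(3 k y) ^ 2 = ln n]: then [8 <= 9] gives the upper
    bound on [Q], and [3 k y <= (Q / 4) ^ 2] gives [ln n <= (Q / 4) ^ 4]. The threshold [X0] ensures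
    [y >= 160 k + 1]. *)
Lemma exists_rounds (R : realType) (k : nat) : (4 <= k)%N ->
  exists n0 : nat, forall n : nat, (n0 <= n)%N -> exists Q : nat,
    [/\ (160 * k <= Q)%N, 8 * k%:R ^+ 2 * Q%:R ^+ 2 <= ln (n%:R : R) &
        0 <= ln (ln (n%:R : R)) <= 4 * ln (Q%:R / 4)].
Proof.
move=> k4; pose X0 : R := (3 * k%:R * (160 * k + 1)%:R) ^+ 2.
exists (Num.truncn (expR X0)).+1 => n n0n.
have kR : 4 <= k%:R :> R by rewrite (ler_nat R 4).
have k3 : 0 < 3 * k%:R :> R by lra.
have nX : expR X0 <= n%:R.
  apply: (@le_trans _ _ (Num.truncn (expR X0)).+1%:R); last by rewrite ler_nat.
  by apply: ltW; apply: truncnS_gt.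
have n_gt0 : 0 < n%:R :> R := lt_le_trans (expR_gt0 _) nX.
set L := ln (n%:R : R).
have LX : X0 <= L by rewrite /L -ler_expR lnK.
have X00 : 0 <= X0 by rewrite sqr_ge0.
have L0 : 0 <= L := le_trans X00 LX.
pose y := Num.sqrt L / (3 * k%:R).
have sE : Num.sqrt L ^+ 2 = L by rewrite sqr_sqrtr.
have y0 : 0 <= y by rewrite divr_ge0 ?sqrtr_ge0 // ltW.
have /andP[Q1 Q2] := truncn_itv y0; set Q := Num.truncn y in Q1 Q2.
have Ly : L = (3 * k%:R * y) ^+ 2.
  by rewrite /y mulrC divfK ?sE // gt_eqF.
have Qk : (160 * k <= Q)%N.
  rewrite -ltnS -(ltr_nat R); apply: le_lt_trans Q2.
  apply: (@le_trans _ _ (160 * k + 1)%:R); first by rewrite ler_nat leq_addr.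
  rewrite /y ler_pdivlMr // mulrC.
  rewrite -(@ler_pXn2r _ 2%N) ?nnegrE ?sqrtr_ge0 ?mulr_ge0 ?(ltW k3) //.
  by rewrite sE.
have QR : 640 <= Q%:R :> R.
  by rewrite (ler_nat R 640); move: k4 Qk; clear; lia.
have QkR : 160 * k%:R <= Q%:R :> R by rewrite -natrM ler_nat.
exists Q; split=> //.
  rewrite -/L Ly exprMn; apply: ler_pM; rewrite ?mulr_ge0 ?exprn_ge0 //.
    by rewrite exprMn ler_wpM2r ?exprn_ge0 // -natrX ler_nat.
  by rewrite lerXn2r ?nnegrE.
have q40 : 0 < Q%:R / 4 :> R by lra.
apply/andP; split.
  rewrite ln_ge0 // (le_trans _ LX) // exprn_ege1 //.
  by apply: mulr_ege1; [lra | rewrite ler1n addn1].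
rewrite -/L mulr_natl -lnXn // ler_ln ?posrE ?exprn_gt0 //; last first.
  by rewrite Ly exprn_gt0 // mulr_gt0 //; lra.
rewrite Ly (exprM _ 2 2).
have h : 3 * k%:R * y <= (Q%:R / 4) ^+ 2.
  apply: (@le_trans _ _ (3 * k%:R * (2 * Q%:R))).
    by rewrite ler_pM2l //; move: Q2; rewrite -natr1; lra.
  by rewrite expr2; nra.
rewrite lerXn2r ?nnegrE ?exprn_ge0 //; last by rewrite ltW.
by rewrite mulr_ge0 // ltW.
Qed.

Unset Implicit Arguments.

Theorem theorem1p2 (R : realType) (k : nat) (hk : (4 <= k)%N) :
  exists (c : R) (n0 : nat), 0 < c /\
    forall n : nat, (n0 <= n)%N ->
      (forall (T : finType) (H : {set {set T}}),
         omitting_system n k (k - 2) H ->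
         exists S : {set T}, independent H S /\
           c * (n%:R `^ (2 / (k - 1)%:R) * ln (ln n%:R) `^ (1 / (k - 1)%:R))
             <= #|S|%:R)
      /\ c * (n%:R `^ (2 / (k - 1)%:R) * ln (ln n%:R) `^ (1 / (k - 1)%:R))
           <= (g n k (k - 2))%:R.
Proof.
have r0 : (0 < k - 1)%N by move: hk; clear; lia.
have kR : 4 <= k%:R :> R by rewrite (ler_nat R 4).
pose K : R := 8 * k%:R * (k + 1)%:R * 5 ^+ (k - 1).
have K0 : 0 < K by rewrite !mulr_gt0 ?exprn_gt0 // ltr0n ?addn1 // (leq_trans _ hk).
have [n0 hn0] := exists_rounds R hk.
(* The [4] pays for [ln (ln n) <= 4 ln (Q / 4)], the division by [2] for the bound being on
   [2 #|S|]. *)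
pose c : R := (K * 4)^-1 `^ (1 / (k - 1)%:R) / 2.
have c0 : 0 < c by rewrite divr_gt0 // powR_gt0 // invr_gt0 mulr_gt0.
exists c, n0; split=> // n n0n; have [Q [Qk Qn /andP[ln0 Qln]]] := hn0 n n0n.
have main (T : finType) (H : {set {set T}}) : omitting_system n k (k - 2) H ->
  exists S : {set T}, independent H S /\
    c * (n%:R `^ (2 / (k - 1)%:R) * ln (ln n%:R) `^ (1 / (k - 1)%:R)) <= #|S|%:R.
  case/and3P=> /eqP Tn /forall_inP Hk /forall_inP Ho; rewrite -Tn in Qn ln0 Qln *.
  have [||S Sind hS] := @omitting_power_bound R k Q T H hk Qk _ _ Qn.
  - by move=> e /Hk /eqP.
  - by move=> e f eH fH ef; have /forall_inP/(_ f fH)/implyP := Ho e eH; apply.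
  exists S; split=> //.
  have L0 : 0 <= ln (Q%:R / 4) :> R.
    exact: le_trans ler01 (ln_q_ge1 R hk Qk).
  have lhs0 (l : R) : 0 <= c * (#|T|%:R `^ (2 / (k - 1)%:R) * l `^ (1 / (k - 1)%:R)).
    by apply: mulr_ge0 (ltW c0) _; rewrite mulr_ge0 ?powR_ge0.
  rewrite -(@ler_pXn2r _ (k - 1)) ?nnegrE //.
  have cE : c ^+ (k - 1) = (K * 4)^-1 / 2 ^+ (k - 1).
    by rewrite expr_div_n powR_root // invr_ge0 mulr_ge0 // ltW.
  have nE : (#|T|%:R `^ (2 / (k - 1)%:R)) ^+ (k - 1) = #|T|%:R ^+ 2 :> R.
    rewrite -powR_mulrn ?powR_ge0 // -powRrM divfK ?powR_mulrn //.
    by rewrite pnatr_eq0 -lt0n.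
  rewrite exprMn cE exprMn nE powR_root //.
  move: hS; rewrite -/K exprMn; set P := 2 ^+ (k - 1); set N := _ ^+ 2 => hS.
  have P0 : 0 < P by rewrite exprn_gt0.
  have -> : (K * 4)^-1 / P * (N * ln (ln #|T|%:R)) =
      N * (ln (ln #|T|%:R) / 4) / K / P.
    by field; rewrite !gt_eqF.
  rewrite ler_pdivrMr // [leRHS]mulrC; apply: le_trans hS.
  rewrite ler_pM2r ?invr_gt0 // ler_wpM2l ?exprn_ge0 //.
  by rewrite ler_pdivrMr // mulrC.
split; first exact: main.
have [[H Hom ->] _] := g_spec n k (k - 2).
have [S [Sind hS]] := main _ H Hom; apply: le_trans hS _; rewrite ler_nat.
exact: leq_bigmax_cond.
Qed.
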